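(* Let $D$ be a vertex-labeled tree of one of the following kinds: (i) a path with $2$ vertices (any labels); (ii) a path with $3$ vertices all of whose labels are equal; (iii) a path with $3$ vertices whose labels, in order along the path, are $a,a,b$, where $b\ge 2a$; (iv) a path (of any length) all of whose vertices are labeled $2$; (v) a star all of whose outer (non-center) vertices are labeled $1$. Then the generalized degree polynomial determines $N_D$: for any two trees $T,T'$ with $\mathbf{G}_T=\mathbf{G}_{T'}$, we have $N_D(T)=N_D(T')$.
   Context: All graphs are finite and simple. For a tree $T$ and $A\subseteq V(T)$, $e(A)$ is the number of edges of $T$ with both endpoints in $A$ and $d(A)$ the number with exactly one endpoint in $A$. The generalized degree polynomial is $\mathbf{G}_T(x,y,z)=\sum_{A\subseteq V(T)} x^{|A|}y^{d(A)}z^{e(A)}$. Let $D$ be a tree whose vertices $u$ are labeled with positive integers $a_u$. A degree embedding of $D$ into $T$ is a graph isomorphism $\varphi\colon D\to T'$ onto a subtree $T'$ of $T$ with $a_u=\deg_T(\varphi(u))$ for all $u\in V(D)$. The degree embedding number $N_D(T)$ is the number of subtrees $T'\subseteq T$ that are the image of some degree embedding of $D$. (For a path $D$ with labels $a_1,\dots,a_m$ in order, $N_D(T)$ is the number of paths $(v_1,\dots,v_m)$ in $T$ with $\deg(v_i)=a_i$, counted up to reversal when the label sequence is palindromic.) A star is a tree consisting of a center vertex joined to some number of outer vertices, with no other edges. *)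

(* Defs.v *)
From mathcomp Require Import all_boot all_order all_algebra.
From mathcomp Require Import mpoly.

Set Implicit Arguments.
Unset Strict Implicit.
Unset Printing Implicit Defensive.

Import GRing.Theory.

Record sgraph := SGraph {
  vert :> finType;
  adj : rel vert;
  adj_sym : ssrbool.symmetric adj;
  adj_irrefl : irreflexive adj }.

Definition deg (G : sgraph) (x : G) : nat := #|[set y | adj x y]|.

Definition edges (G : sgraph) : {set {set G}} :=
  [set [set p.1; p.2] | p : G * G & adj p.1 p.2].

(* A duplicate-free cyclic sequence of length at most 2 is not a graph cycle:
   [:: x; y] only runs twice along the edge xy.  Since cycles are
   duplicate-free, bounding their length by #|G| loses nothing (acyclicP). *)
Definition acyclic (G : sgraph) : bool :=
  [forall n : 'I_#|G|.+1, forall c : n.-tuple G,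
     ucycleb (@adj G) c ==> (n <= 2)].

Lemma acyclicP (G : sgraph) :
  reflect (forall c : seq G, ucycle (@adj G) c -> size c <= 2) (acyclic G).
Proof.
apply: (iffP forallP) => [acG c cyc | acG n].
  have lec : size c < #|G|.+1.
    by case/andP: cyc => _ /card_uniqP <-; rewrite ltnS max_card.
  have /forallP/(_ (in_tuple c)) := acG (Ordinal lec).
  by rewrite (cyc : ucycleb _ _).
apply/forallP => c; apply/implyP => cyc.
by rewrite -{1}(size_tuple c); apply: acG.
Qed.

Definition connectedg (G : sgraph) : bool :=
  [forall x : G, forall y : G, connect (@adj G) x y].

Definition is_tree (G : sgraph) : bool :=
  [&& 0 < #|G|, connectedg G & acyclic G].

Definition e_in (G : sgraph) (A : {set G}) : nat :=
  #|[set e in edges G | e \subset A]|.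

Definition d_out (G : sgraph) (A : {set G}) : nat :=
  #|[set e in edges G | #|e :&: A| == 1]|.

Definition gdp (G : sgraph) : {mpoly int[3]} :=
  (let x := 'X_(@Ordinal 3 0 isT) in
   let y := 'X_(@Ordinal 3 1 isT) in
   let z := 'X_(@Ordinal 3 2 isT) in
   \sum_(A : {set G}) x ^+ #|A| * y ^+ d_out A * z ^+ e_in A)%R.

(* A candidate subgraph of G: a vertex set paired with an edge set. *)
Definition subg_data (G : sgraph) : Type := ({set G} * {set {set G}})%type.

Definition is_subgraph (G : sgraph) (H : subg_data G) : bool :=
  (H.2 \subset edges G) && [forall e in H.2, e \subset H.1].

Section SubGraph.
Variables (G : sgraph) (H : subg_data G).

Definition subg_vert : finType := {x : G | x \in H.1}.

(* The inequality is redundant when is_subgraph H holds; it makes the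
   construction total. *)
Definition subg_adj : rel subg_vert :=
  fun x y => (val x != val y) && ([set val x; val y] \in H.2).

Lemma subg_adj_sym : ssrbool.symmetric subg_adj.
Proof. by move=> x y; rewrite /subg_adj eq_sym setUC. Qed.

Lemma subg_adj_irrefl : irreflexive subg_adj.
Proof. by move=> x; rewrite /subg_adj eqxx. Qed.

Definition subg : sgraph := SGraph subg_adj_sym subg_adj_irrefl.

End SubGraph.

Definition is_iso (D G : sgraph) (f : {ffun D -> G}) : bool :=
  [&& injectiveb f, [forall y, y \in codom f] &
      [forall u, forall v, adj (f u) (f v) == adj u v]].

Definition is_deg_embedding (D : sgraph) (a : D -> nat) (T : sgraph)
    (H : subg_data T) (phi : {ffun D -> subg H}) : bool :=
  is_iso phi && [forall u, a u == deg (val (phi u) : T)].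

Definition deg_emb_num (D : sgraph) (a : D -> nat) (T : sgraph) : nat :=
  #|[set H : subg_data T |
      [&& is_subgraph H, is_tree (subg H) &
          [exists phi : {ffun D -> subg H}, is_deg_embedding a phi]]]|.

(* f lists the vertices of D in order along a path with m vertices. *)
Definition path_order (D : sgraph) (m : nat) (f : 'I_m -> D) : Prop :=
  bijective f /\
  forall i j : 'I_m, adj (f i) (f j) = (i.+1 == j :> nat) || (j.+1 == i :> nat).

Definition path2 (D : sgraph) : Prop :=
  exists f : 'I_2 -> D, path_order f.

Definition path3_const (D : sgraph) (a : D -> nat) : Prop :=
  (exists f : 'I_3 -> D, path_order f) /\ (forall u v, a u = a v).

Definition path3_aab (D : sgraph) (a : D -> nat) : Prop :=
  exists f : 'I_3 -> D, path_order f /\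
  exists p q : nat,
    [/\ a (f (@Ordinal 3 0 isT)) = p, a (f (@Ordinal 3 1 isT)) = p,
        a (f (@Ordinal 3 2 isT)) = q & 2 * p <= q].

Definition path_all2 (D : sgraph) (a : D -> nat) : Prop :=
  (exists (m : nat) (f : 'I_m -> D), path_order f) /\ (forall u, a u = 2).

Definition star_center (D : sgraph) (c : D) : Prop :=
  forall x y : D, adj x y = (x != y) && ((x == c) || (y == c)).

Definition star_outer1 (D : sgraph) (a : D -> nat) : Prop :=
  exists c : D, star_center c /\ (forall u, u != c -> a u = 1).

(* Main.v *)
Require Import Defs.
From mathcomp Require Import all_boot all_order all_algebra.
From mathcomp Require Import mpoly.
From mathcomp Require Import ring zify.

(** The polynomial determines the distribution of (|A|, sum of degrees over A,
    e(A)) over the vertex sets A.  Give each vertex v the weight x y^(deg v):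
    expanding (1 + w)^e(A) over edge sets and dividing by the product of all
    1 + x y^(deg v) shows that, for every k, the sum over the k-edge subsets F
    of the product of f(deg v), v in the support of F, is determined, where
    f(d) = x y^d / (1 + x y^d).  For fixed a the substitution
    x = - (1 - eps) / y^a makes f(a), and no other f(d), have a pole at eps = 0,
    and the polar parts isolate local statistics around vertices of degree a:
    - k = 1 and 2 give linear relations in the values y^j / (1 - y^j), which are
      linearly independent; they determine the numbers of edges with given end
      degrees (by induction on the smaller one) and the numbers of paths a,a,a,
      and for paths a,a,b only the differences between b = a + j and b = a - j,
      the latter term being absent when b >= 2a;
    - for a = 2 and all k, the leading terms give the matching polynomial of the
      linear forest induced by the vertices of degree 2; at a suitable activity
      it is a product of factors (1 - s^(m+1)) / (1 - s) over the components, m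
      being their sizes, and such a product determines its exponents;
    - for a = 1 the analogous limit of the polynomial itself is a product of
      factors 1 - y^(deg v - 1) t^(l v) over the inner vertices v, l v being the
      number of leaves at v.
    Embeddings of D, rather than their images, are counted throughout: they are
    more numerous by the number of label-preserving automorphisms of D. *)

Set Implicit Arguments.
Unset Strict Implicit.
Unset Printing Implicit Defensive.
Import GRing.Theory Num.Theory.

(** * Products of factors 1 - s^n and rational functions regular at 0 *)

Local Open Scope ring_scope.

Section Euler.
Variable R : numDomainType.

Lemma coef0_prod_1subXn (s : seq nat) : all (leq 1) s ->
  (\prod_(m <- s) (1 - 'X^m) : {poly R})`_0 = 1.
Proof.
elim: s => [|m s IH] /=; first by rewrite big_nil coefC.
case/andP=> m0 /IH {}IH; rewrite big_cons coef0M IH coefB coef1 coefXn /=.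
by case: m m0 => //= m _; rewrite subr0 mulr1.
Qed.

(** Modulo [X^(n+1)] a factor of exponent above [n] is 1, and [(1 - X^n)^k] is [1 - k X^n]. *)
Lemma coef_min_prod_1subXn (n : nat) (s : seq nat) : (0 < n)%N -> all (leq n) s ->
  (\prod_(m <- s) (1 - 'X^m) : {poly R})`_n = - (count_mem n s)%:R.
Proof.
move=> n0; elim: s => [|m s IH] /=.
  by rewrite big_nil coef1 eqn0Ngt n0 oppr0.
case/andP=> nm ns; rewrite big_cons mulrBl mul1r coefB IH // coefXnM.
case: ltnP => mn.
  have /negPf -> : m != n by rewrite neq_ltn mn orbT.
  by rewrite subr0.
have -> : m = n by apply/eqP; rewrite eqn_leq mn nm.
rewrite subnn coef0_prod_1subXn; last by apply: sub_all ns => k; apply: leq_trans.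
by rewrite eqxx natrD opprD addrC.
Qed.

(* The least exponent is visible as the first nonzero coefficient, so it can
   be cancelled from both sides. *)
Lemma euler_product_uniq (s t : seq nat) : all (leq 1) s -> all (leq 1) t ->
  \prod_(m <- s) (1 - 'X^m) = \prod_(m <- t) (1 - 'X^m) :> {poly R} ->
  perm_eq s t.
Proof.
have [k] := ubnP (size s + size t)%N; elim: k s t => // k IH u v.
case E0 : (size u + size v)%N => [|l]; first by case: u v E0 => [|? ?] [].
move: E0; set l1 := l.+1; have l1_gt0 : (0 < l1)%N by []; move: l1 l1_gt0 => {}l l_gt0.
(* The least exponent occurs in [u] or in [v], and the claim is symmetric in them. *)
wlog [n [nu [un vn]]] : u v / exists n : nat, n \in u /\ all (leq n) u /\ all (leq n) v.
  move=> W sz lk u0 v0 E.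
  have [n n_in n_min] : exists2 n : nat, n \in u ++ v & forall m, m \in u ++ v -> (n <= m)%N.
    have ex : exists n : nat, n \in u ++ v.
      move: (size_cat u v); rewrite sz; case: (u ++ v) => [|b r] l0; first by rewrite -l0 in l_gt0.
      by exists b; rewrite mem_head.
    by exists (ex_minn ex); case: ex_minnP.
  have un : all (leq n) u by apply/allP => m mu; apply: n_min; rewrite mem_cat mu.
  have vn : all (leq n) v by apply/allP => m mu; apply: n_min; rewrite mem_cat mu orbT.
  move: n_in; rewrite mem_cat => /orP[] nn.
    by apply: W => //; exists n.
  by rewrite perm_sym; apply: W => //; [exists n | rewrite addnC].
move=> sz lk u0 v0 E.
have n0 : (0 < n)%N by move/allP: u0; apply.
(* The coefficient at [n] is minus the multiplicity of [n] on either side, and this is non-zero for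
   [u]. *)
have nv : n \in v.
  move/(congr1 (fun p : {poly R} => p`_n)): E.
  rewrite !coef_min_prod_1subXn // => /oppr_inj/eqP; rewrite eqr_nat => /eqP E.
  by rewrite -has_pred1 has_count -E -has_count has_pred1.
have pu := perm_to_rem nu; have pv := perm_to_rem nv.
rewrite (perm_trans pu) // perm_sym (perm_trans pv) // perm_cons perm_sym.
have sub w : all (leq 1) w -> all (leq 1) (rem n w).
  by move=> /allP w1; apply/allP => m /mem_rem; apply: w1.
apply: IH; rewrite ?sub ?size_rem //.
  have : (0 < size u)%N by case: (u) nu.
  have : (0 < size v)%N by case: (v) nv.
  move: sz lk; case: (size u) => [|b] //; case: (size v) => [|b'] //= <-; lia.
move: E; rewrite (perm_big _ pu) (perm_big _ pv) !big_cons; apply: mulfI.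
rewrite subr_eq0; apply/eqP => /(congr1 (fun p : {poly R} => p`_0)).
by rewrite coef1 coefXn /= eq_sym eqn0Ngt n0 => /eqP; rewrite oner_eq0.
Qed.
End Euler.

Local Notation "x %:F" := (tofrac x) : ring_scope.

Definition ratfun (F : fieldType) : fieldType := {fraction {poly F}}.

Section Regular.
Variable F : fieldType.
Notation K := (ratfun F).
Implicit Types (r q : K) (c d : F).

Definition cst : {rmorphism F -> K} :=
  (@tofrac {poly F} \o polyC : {rmorphism F -> {fraction {poly F}}}).
Definition eps : K := ('X)%:F.

Lemma eps_neq0 : eps != 0.
Proof. by rewrite tofrac_eq0 polyX_eq0. Qed.

(* [r] is a rational function without pole at 0, with value [c] there. *)
Definition reg r c : Prop :=
  exists n d : {poly F}, [/\ d.[0] != 0, r * d%:F = n%:F & c * d.[0] = n.[0]].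

(** Cross-multiply the two presentations and evaluate at 0. This turns every identity of rational
    functions below into an identity between values at 0. *)
Lemma reg_uniq r c c' : reg r c -> reg r c' -> c = c'.
Proof.
move=> [n [d [d0 rd cd]]] [n' [d' [d0' rd' cd']]].
have : n * d' = n' * d.
  apply/eqP; rewrite -tofrac_eq !tofracM -rd -rd'; apply/eqP; ring.
move/(congr1 (fun p => p.[0])); rewrite !hornerM -cd -cd' => E.
apply: (mulIf (mulf_neq0 d0 d0')); rewrite mulrA E; ring.
Qed.

Lemma reg_cst c : reg (cst c) c.
Proof. by exists c%:P, 1; split; rewrite ?hornerE ?oner_neq0 ?tofrac1 ?mulr1. Qed.

Lemma reg0 : reg 0 0.
Proof. by have := reg_cst 0; rewrite rmorph0. Qed.

Lemma reg1 : reg 1 1.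
Proof. by have := reg_cst 1; rewrite rmorph1. Qed.

Lemma reg_eps : reg eps 0.
Proof. by exists 'X, 1; split; rewrite ?hornerE ?oner_neq0 ?tofrac1 ?mulr1. Qed.

Lemma regD r q c d : reg r c -> reg q d -> reg (r + q) (c + d).
Proof.
move=> [n [m [m0 rd cd]]] [n' [m' [m0' rd' cd']]].
exists (n * m' + n' * m), (m * m'); split; first by rewrite hornerM mulf_neq0.
  by rewrite !tofracD !tofracM -rd -rd'; ring.
by rewrite ?hornerD !hornerM -cd -cd'; ring.
Qed.

Lemma regM r q c d : reg r c -> reg q d -> reg (r * q) (c * d).
Proof.
move=> [n [m [m0 rd cd]]] [n' [m' [m0' rd' cd']]].
exists (n * n'), (m * m'); split; first by rewrite hornerM mulf_neq0.
  by rewrite !tofracM -rd -rd'; ring.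
by rewrite ?hornerD !hornerM -cd -cd'; ring.
Qed.

Lemma regN r c : reg r c -> reg (- r) (- c).
Proof.
by move=> rc; have := regM (reg_cst (-1)) rc; rewrite rmorphN1 !mulN1r.
Qed.

Lemma regB r q c d : reg r c -> reg q d -> reg (r - q) (c - d).
Proof. by move=> rc qd; apply: regD => //; apply: regN. Qed.

Lemma reg_neq0 r c : reg r c -> c != 0 -> r != 0.
Proof. by move=> rc; apply: contraNneq => r0; rewrite r0 in rc; rewrite (reg_uniq rc reg0). Qed.

Lemma regV r c : c != 0 -> reg r c -> reg r^-1 c^-1.
Proof.
move=> c0 rc; have r0 := reg_neq0 rc c0; case: rc => [n [m [m0 rd cd]]].
exists m, n; rewrite -cd -rd mulf_neq0 //; split=> //; first by rewrite mulKf.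
by rewrite mulKf.
Qed.

Lemma regX r c n : reg r c -> reg (r ^+ n) (c ^+ n).
Proof.
by move=> rc; elim: n => [|n IH]; [exact: reg1 | rewrite !exprS; apply: regM].
Qed.

Lemma reg_sum I (s : seq I) (P : pred I) (f : I -> K) (h : I -> F) :
  (forall i, P i -> reg (f i) (h i)) ->
  reg (\sum_(i <- s | P i) f i) (\sum_(i <- s | P i) h i).
Proof. by move=> fh; apply: (big_ind2 reg) => [||//]; [exact: reg0 | move=> *; exact: regD]. Qed.

Lemma reg_prod I (s : seq I) (P : pred I) (f : I -> K) (h : I -> F) :
  (forall i, P i -> reg (f i) (h i)) ->
  reg (\prod_(i <- s | P i) f i) (\prod_(i <- s | P i) h i).
Proof. by move=> fh; apply: (big_ind2 reg) => [||//]; [exact: reg1 | move=> *; exact: regM]. Qed.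

(** Since [eps] is not a root of unity, it can serve as the base [y] when a second variable is
    adjoined: later computations take place in rational functions over [ratfun rat]. *)
Lemma epsX_neq1 k : (0 < k)%N -> eps ^+ k != 1.
Proof.
move=> k0; apply/eqP => E; have := regX k reg_eps; rewrite E expr0n.
by rewrite eqn0Ngt k0 /= => /(reg_uniq reg1)/eqP; rewrite oner_eq0.
Qed.

End Regular.

Lemma euler_product_eps_uniq (s t : seq nat) : all (leq 1) s -> all (leq 1) t ->
  \prod_(m <- s) (1 - eps rat ^+ m) = \prod_(m <- t) (1 - eps rat ^+ m) ->
  perm_eq s t.
Proof.
have aux r : \prod_(m <- r) (1 - eps rat ^+ m) = tofrac (\prod_(m <- r) (1 - 'X^m)).
  by rewrite rmorph_prod; apply: eq_bigr => m _; rewrite /= tofracB tofracXn tofrac1.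
move=> s1 t1; rewrite !aux => /eqP; rewrite tofrac_eq => /eqP.
exact: euler_product_uniq.
Qed.

Global Opaque ratfun cst eps reg.

Lemma div_exp_shift (L : fieldType) (s b c : L) (j k : nat) : s != 0 -> (k <= j)%N ->
  c * (s ^+ j.+1 / b) / s ^+ k.+1 = c * s ^+ (j - k) * b^-1.
Proof.
move=> s0 kj; have -> : j.+1 = (j - k + k.+1)%N by rewrite addnS subnK.
by rewrite exprD [_ * _ / b]mulrAC mulrA mulfK ?mulrA // expf_neq0.
Qed.

(* Lambert series: the coefficient of least index is read off at [eps = 0] after
   division by the corresponding power of [eps]. *)
Lemma lambert_independent (F : fieldType) n (c : F) (g : nat -> F) :
  cst _ c + \sum_(k < n) cst _ (g k) * (eps F ^+ k.+1 / (1 - eps F ^+ k.+1)) = 0 ->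
  forall k, (k < n)%N -> g k = 0.
Proof.
move=> E.
have r1V k : reg ((1 - eps F ^+ k.+1)^-1) 1.
  have := regB (reg1 _) (regX k.+1 (reg_eps F)); rewrite expr0n subr0 => r1.
  by have := regV (oner_neq0 _) r1; rewrite invr1.
(* At [eps = 0] every Lambert term vanishes and only the constant is left. *)
have c0 : c = 0.
  apply: (@reg_uniq _ 0); last exact: reg0.
  rewrite -E -[X in reg _ X]addr0; apply: regD; first exact: reg_cst.
  have -> : 0 = \sum_(k < n) g k * (0 ^+ k.+1 * 1).
    by rewrite big1 // => k _; rewrite expr0n mul0r mulr0.
  apply: reg_sum => k _; apply: (regM (reg_cst _)); apply: (regM _ (r1V k)).
  exact/regX/reg_eps.
move: E; rewrite c0 rmorph0 add0r => E.
elim/ltn_ind => k IH kn.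
apply: (@reg_uniq _ 0); last exact: reg0.
(* After division by [eps ^+ k.+1], the terms below [k] are zero by induction and those above [k]
   keep a positive power of [eps]. *)
have -> : 0 = \sum_(j < n) cst _ (g j) * (eps F ^+ j.+1 / (1 - eps F ^+ j.+1)) / eps F ^+ k.+1.
  by rewrite -mulr_suml E mul0r.
have -> : g k = \sum_(j < n) (if j == Ordinal kn then g k else 0) by rewrite -big_mkcond big_pred1_eq.
apply: reg_sum => j _; case: (ltnP j k) => jk.
  by rewrite IH // rmorph0 !mul0r -val_eqE /= ltn_eqF //; apply: reg0.
rewrite (div_exp_shift _ _ (eps_neq0 F) jk).
have -> : (if j == Ordinal kn then g k else 0) = g j * 0 ^+ (j - k) * 1.
  rewrite -val_eqE /= expr0n subn_eq0 mulr1 eq_sym eqn_leq jk /=.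
  case: leqP => [kj|_]; last by rewrite mulr0.
  by rewrite mulr1 (_ : k = j) //; apply/eqP; rewrite eqn_leq jk kj.
by apply: (regM _ (r1V j)); apply: (regM (reg_cst _)); exact/regX/reg_eps.
Qed.

Local Close Scope ring_scope.

Local Open Scope ring_scope.

(** * Polar parts at a chosen degree *)

Section Pole.
Variables (F : fieldType) (y : F) (a : nat).
Hypothesis y_neq0 : y != 0.
Hypothesis yX_neq1 : forall k, (0 < k)%N -> y ^+ k != 1.
Notation K := (ratfun F).

(* With [x = - (1 - eps) / y ^ a], the weight [x y^d / (1 + x y^d)] has a pole
   at [eps = 0] exactly for [d = a]. *)
Definition pole_x : K := - (1 - eps F) / cst F y ^+ a.
Definition wt (d : nat) : K := pole_x * cst F y ^+ d.
Definition frac_wt (d : nat) : K := wt d / (1 + wt d).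
Definition wt0 (d : nat) : F := - (y ^+ d / y ^+ a).
(* [frac_wt0 a = 0], by division by zero. *)
Definition frac_wt0 (d : nat) : F := wt0 d / (1 + wt0 d).

Lemma cst_y_neq0 : cst F y != 0.
Proof. by rewrite fmorph_eq0. Qed.

Lemma wt_pole : wt a = eps F - 1.
Proof. by rewrite /wt divfK ?expf_neq0 ?cst_y_neq0 // opprB. Qed.

Lemma add1_wt_pole : 1 + wt a = eps F.
Proof. by rewrite wt_pole addrC subrK. Qed.

Lemma reg_wt d : reg (wt d) (wt0 d).
Proof.
have -> : wt d = - ((1 - eps F) * cst F (y ^+ d / y ^+ a)).
  by rewrite fmorph_div !rmorphXn /= /wt /pole_x !mulNr mulrA mulrAC.
have -> : wt0 d = - ((1 - 0) * (y ^+ d / y ^+ a)) by rewrite subr0 mul1r.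
by apply: regN; apply: (regM _ (reg_cst _)); exact: (regB (reg1 _) (reg_eps _)).
Qed.

Lemma wt0_pole : wt0 a = -1.
Proof. by rewrite /wt0 divff // expf_neq0. Qed.

(** Equality would mean [y ^+ d = y ^+ a], making [y] a root of unity. *)
Lemma add1_wt0_neq0 d : d != a -> 1 + wt0 d != 0.
Proof.
move=> da; have yd k : y ^+ k != 0 by rewrite expf_neq0.
rewrite subr_eq0; apply/eqP => /esym/divr1_eq; case: (ltngtP d a) da => // lt _ E.
  have := yX_neq1 (_ : 0 < a - d)%N; rewrite subn_gt0 => /(_ lt)/eqP; apply.
  by apply: (mulIf (yd d)); rewrite -exprD subnK ?mul1r 1?ltnW.
have := yX_neq1 (_ : 0 < d - a)%N; rewrite subn_gt0 => /(_ lt)/eqP; apply.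
by apply: (mulIf (yd a)); rewrite -exprD subnK ?mul1r 1?ltnW.
Qed.

Lemma add1_wt_neq0 d : 1 + wt d != 0.
Proof.
have [->|da] := eqVneq d a; first by rewrite add1_wt_pole eps_neq0.
by apply: reg_neq0 (add1_wt0_neq0 da); apply: regD (reg_wt d); apply: reg1.
Qed.

Lemma reg_frac_wt d : d != a -> reg (frac_wt d) (frac_wt0 d).
Proof.
move=> da; apply: regM (reg_wt d) _; apply: regV (add1_wt0_neq0 da) _.
exact: regD (reg1 _) (reg_wt d).
Qed.

Lemma frac_wt0_pole : frac_wt0 a = 0.
Proof. by rewrite /frac_wt0 wt0_pole subrr invr0 mulr0. Qed.

(** [frac_wt a] is [(eps - 1) / eps], a simple pole of residue -1, while the other weights are
    regular. *)
Lemma reg_eps_frac_wt d : reg (eps F * frac_wt d) (- (d == a)%:R).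
Proof.
have [->|da] /= := eqVneq d a.
  rewrite /frac_wt add1_wt_pole wt_pole mulrC divfK ?eps_neq0 //.
  by have := regB (reg_eps F) (reg1 F); rewrite sub0r.
by rewrite oppr0 -[X in reg _ X](mul0r (frac_wt0 d)); apply: regM (reg_eps _) (reg_frac_wt da).
Qed.

(** The weight of the middle vertex of a three-vertex path in the second cumulant; at [d = a] its
    pole is double. *)
Definition mid_wt (d : nat) : K := frac_wt d - frac_wt d ^+ 2.

Lemma reg_mid_wt d : d != a -> reg (mid_wt d) (frac_wt0 d - frac_wt0 d ^+ 2).
Proof. by move=> da; apply: regB (reg_frac_wt da) (regX 2 (reg_frac_wt da)). Qed.

Lemma reg_eps_mid_wt d : reg (eps F ^+ 2 * mid_wt d) (- (d == a)%:R).
Proof.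
have -> : eps F ^+ 2 * mid_wt d =
  eps F * (eps F * frac_wt d) - (eps F * frac_wt d) ^+ 2.
  by rewrite /mid_wt; ring.
have -> : - (d == a)%:R = 0 * (- (d == a)%:R) - (- (d == a)%:R) ^+ 2 :> F.
  by case: (d == a) => /=; rewrite ?mulr1n ?mulr0n; ring.
exact: regB (regM (reg_eps _) (reg_eps_frac_wt d)) (regX 2 (reg_eps_frac_wt d)).
Qed.

Lemma sum_pole B (G : nat -> F) : (a < B)%N ->
  \sum_(i < B) (i == a :> nat)%:R * G i = G a.
Proof.
move=> aB; rewrite (bigD1 (Ordinal aB)) //= eqxx mul1r big1 ?addr0 // => i.
by rewrite -val_eqE /= => /negPf ->; rewrite mul0r.
Qed.

(** A double pole arises only from [i = j = a]. Once that coefficient vanishes, the simple poles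
    come from the pairs with exactly one index [a], the other weight being taken at [eps = 0]. *)
Lemma pole2 B (delta : nat -> nat -> F) : (a < B)%N ->
  \sum_(i < B) \sum_(j < B) cst F (delta i j) * (frac_wt i * frac_wt j) = 0 ->
  delta a a = 0 /\ \sum_(j < B) (delta a j + delta j a) * frac_wt0 j = 0.
Proof.
move=> aB E.
have daa : delta a a = 0.
  apply: (@reg_uniq _ 0); last exact: reg0.
  have -> : 0 = \sum_(i < B) \sum_(j < B)
     cst F (delta i j) * ((eps F * frac_wt i) * (eps F * frac_wt j)).
    rewrite -[LHS](mulr0 (eps F ^+ 2)) -[X in _ * X]E mulr_sumr.
    apply: eq_bigr => i _; rewrite mulr_sumr; apply: eq_bigr => j _.
    by rewrite expr2; ring.
  have -> : delta a a = \sum_(i < B) (i == a :> nat)%:R *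
      (\sum_(j < B) (j == a :> nat)%:R * delta i j).
    by rewrite (sum_pole (fun i => \sum_(j < B) (j == a :> nat)%:R * delta i j)) // sum_pole.
  apply: reg_sum => i _; rewrite mulr_sumr; apply: reg_sum => j _.
  have -> : (i == a :> nat)%:R * ((j == a :> nat)%:R * delta i j) =
    delta i j * ((- (i == a :> nat)%:R) * (- (j == a :> nat)%:R)) by ring.
  by apply: (regM (reg_cst _)); apply: regM; apply: reg_eps_frac_wt.
split=> //; apply: (@reg_uniq _ 0); last exact: reg0.
(* Multiplying by [- eps] compensates the residue -1. *)
have -> : 0 = - \sum_(i < B) \sum_(j < B)
    cst F (delta i j) * (eps F * (frac_wt i * frac_wt j)).
  rewrite -[LHS]oppr0 -[X in - X](mulr0 (eps F)) -[X in _ * X]E mulr_sumr.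
  congr (- _); apply: eq_bigr => i _; rewrite mulr_sumr; apply: eq_bigr => j _.
  by rewrite mulrCA.
have -> : \sum_(j < B) (delta a j + delta j a) * frac_wt0 j =
  - \sum_(i < B) \sum_(j < B) delta i j *
    - ((i == a :> nat)%:R * frac_wt0 j + (j == a :> nat)%:R * frac_wt0 i).
  transitivity (\sum_(i < B) (i == a :> nat)%:R * (\sum_(j < B) delta i j * frac_wt0 j) +
    \sum_(j < B) (j == a :> nat)%:R * (\sum_(i < B) delta i j * frac_wt0 i)).
    rewrite (sum_pole (fun i => \sum_(j < B) delta i j * frac_wt0 j)) //.
    rewrite (sum_pole (fun j => \sum_(i < B) delta i j * frac_wt0 i)) // -big_split.
    by apply: eq_bigr => j _; rewrite mulrDl.
  under [X in _ + X]eq_bigr do rewrite mulr_sumr.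
  rewrite [X in _ + X]exchange_big -big_split -sumrN /=; apply: eq_bigr => i _.
  rewrite mulr_sumr -big_split -sumrN /=; apply: eq_bigr => j _.
  by ring.
apply: regN; apply: reg_sum => i _; apply: reg_sum => j _.
have [->|ia] := eqVneq (i : nat) a; have [->|ja] := eqVneq (j : nat) a.
- by rewrite daa rmorph0 !mul0r; apply: reg0.
- rewrite mul0r addr0; apply: (regM (reg_cst _)); rewrite mulrA -mulNr.
  by apply: (regM _ (reg_frac_wt ja)); have := reg_eps_frac_wt a; rewrite eqxx.
- rewrite mul0r add0r; apply: (regM (reg_cst _)).
  rewrite mulrCA -mulNr [X in reg _ X]mulrC.
  by apply: (regM (reg_frac_wt ia)); have := reg_eps_frac_wt a; rewrite eqxx.
- rewrite !mul0r addr0 oppr0; apply: (regM (reg_cst _)).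
  rewrite -[X in reg _ X](mul0r (frac_wt0 i * frac_wt0 j)).
  by apply: (regM (reg_eps _)); apply: regM; apply: reg_frac_wt.
Qed.

(** The order of the pole is 4 only at [i = j = k = a], and 3 only when [j = a] and exactly one end
    is [a]; two ends [a] around another middle degree give order 2 only. *)
Lemma pole3 B (delta : nat -> nat -> nat -> F) : (a < B)%N ->
  \sum_(i < B) \sum_(j < B) \sum_(k < B)
     cst F (delta i j k) * (frac_wt i * mid_wt j * frac_wt k) = 0 ->
  delta a a a = 0 /\
  \sum_(k < B) (delta a a k + delta k a a) * frac_wt0 k = 0.
Proof.
move=> aB E.
have sum3 (G : nat -> nat -> nat -> F) : \sum_(i < B) \sum_(j < B) \sum_(k < B)
    (i == a :> nat)%:R * ((j == a :> nat)%:R * G i j k) = \sum_(k < B) G a a k.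
  under eq_bigr do (under eq_bigr do rewrite -mulr_sumr; rewrite -mulr_sumr).
  rewrite (sum_pole (fun i => \sum_(j < B) \sum_(k < B) (j == a :> nat)%:R * G i j k)) //.
  under eq_bigr do rewrite -mulr_sumr.
  exact: (sum_pole (fun j => \sum_(k < B) G a j k)).
have daa : delta a a a = 0.
  apply: (@reg_uniq _ 0); last exact: reg0.
  have -> : 0 = \sum_(i < B) \sum_(j < B) \sum_(k < B) - cst F (delta i j k) *
    ((eps F * frac_wt i) * (eps F ^+ 2 * mid_wt j) * (eps F * frac_wt k)).
    rewrite -[LHS](mulr0 (- eps F ^+ 4)) -[X in _ * X]E mulr_sumr.
    apply: eq_bigr => i _; rewrite mulr_sumr; apply: eq_bigr => j _.
    by rewrite mulr_sumr; apply: eq_bigr => k _; ring.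
  rewrite -(sum_pole (fun k => delta a a k) aB).
  rewrite -(sum3 (fun i j k => (k == a :> nat)%:R * delta i j k)).
  do 3![apply: reg_sum => ? _]; rewrite -rmorphN.
  have -> (c1 c2 c3 c4 : F) : c1 * (c2 * (c3 * c4)) = - c4 * ((- c1) * (- c2) * (- c3)) by ring.
  apply: (regM (reg_cst _)); apply: (regM _ (reg_eps_frac_wt _)).
  exact: (regM (reg_eps_frac_wt _) (reg_eps_mid_wt _)).
split=> //; apply: (@reg_uniq _ 0); last exact: reg0.
have -> : 0 = \sum_(i < B) \sum_(j < B) \sum_(k < B)
    cst F (delta i j k) * (eps F ^+ 3 * (frac_wt i * mid_wt j * frac_wt k)).
  rewrite -[LHS](mulr0 (eps F ^+ 3)) -[X in _ * X]E mulr_sumr.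
  apply: eq_bigr => i _; rewrite mulr_sumr; apply: eq_bigr => j _.
  by rewrite mulr_sumr; apply: eq_bigr => k _; rewrite mulrCA.
have -> : \sum_(k < B) (delta a a k + delta k a a) * frac_wt0 k =
  \sum_(i < B) \sum_(j < B) \sum_(k < B) delta i j k * ((j == a :> nat)%:R *
    ((i == a :> nat)%:R * frac_wt0 k + (k == a :> nat)%:R * frac_wt0 i)).
  under eq_bigr do rewrite mulrDl.
  rewrite big_split /= -(sum3 (fun i j k => delta i j k * frac_wt0 k)).
  rewrite -(sum3 (fun k j i => delta i j k * frac_wt0 i)).
  have -> : \sum_(i < B) \sum_(j < B) \sum_(k < B) (i == a :> nat)%:R *
     ((j == a :> nat)%:R * (delta k j i * frac_wt0 k)) =
     \sum_(i < B) \sum_(j < B) \sum_(k < B) (k == a :> nat)%:R *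
     ((j == a :> nat)%:R * (delta i j k * frac_wt0 i)).
    under eq_bigr do rewrite exchange_big /=.
    by rewrite exchange_big /=; apply: eq_bigr => i _; rewrite exchange_big.
  rewrite -big_split; apply: eq_bigr => i _; rewrite -big_split; apply: eq_bigr => j _.
  by rewrite -big_split; apply: eq_bigr => k _ /=; ring.
apply: reg_sum => i _; apply: reg_sum => j _; apply: reg_sum => k _.
have R1 : reg (eps F * frac_wt a) (-1) by have := reg_eps_frac_wt a; rewrite eqxx.
have R2 : reg (eps F ^+ 2 * mid_wt a) (-1) by have := reg_eps_mid_wt a; rewrite eqxx.
(* With a regular middle weight the pole has order at most 2, so a factor [eps] is left over. *)
have [->|ja] /= := eqVneq (j : nat) a; last first.
  apply: (regM (reg_cst _)); rewrite mul0r.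
  have -> : eps F ^+ 3 * (frac_wt i * mid_wt j * frac_wt k) =
    eps F * ((eps F * frac_wt i) * (eps F * frac_wt k) * mid_wt j) by ring.
  rewrite -[X in reg _ X](mul0r (- (i == a :> nat)%:R * - (k == a :> nat)%:R *
     (frac_wt0 j - frac_wt0 j ^+ 2))).
  apply: (regM (reg_eps _)); apply: (regM _ (reg_mid_wt ja)).
  by apply: regM; apply: reg_eps_frac_wt.
have [->|ia] := eqVneq (i : nat) a; have [->|ka] := eqVneq (k : nat) a.
- by rewrite daa rmorph0 !mul0r; apply: reg0.
- apply: (regM (reg_cst _)).
  have -> : eps F ^+ 3 * (frac_wt a * mid_wt a * frac_wt k) =
    (eps F * frac_wt a) * (eps F ^+ 2 * mid_wt a) * frac_wt k by ring.
  have := regM (regM R1 R2) (reg_frac_wt ka).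
  by rewrite mulrNN !mul1r mul0r addr0.
- apply: (regM (reg_cst _)).
  have -> : eps F ^+ 3 * (frac_wt i * mid_wt a * frac_wt a) =
    (eps F * frac_wt a) * (eps F ^+ 2 * mid_wt a) * frac_wt i by ring.
  have := regM (regM R1 R2) (reg_frac_wt ia).
  by rewrite mulrNN !mul1r mul0r add0r.
- apply: (regM (reg_cst _)).
  have -> : eps F ^+ 3 * (frac_wt i * mid_wt a * frac_wt k) =
    eps F * ((eps F ^+ 2 * mid_wt a) * (frac_wt i * frac_wt k)) by ring.
  have := regM (reg_eps _) (regM R2 (regM (reg_frac_wt ia) (reg_frac_wt ka))).
  by rewrite !mul0r addr0 mulr0.
Qed.

End Pole.

Local Close Scope ring_scope.

(** * Limit weights as Lambert values *)

Local Open Scope ring_scope.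

(** Below [a] the power of [y] occurs inverted; this rewrites such a weight as 1 plus a Lambert
    value. *)
Lemma div_inv_sub1 (L : fieldType) (t : L) : t != 0 -> 1 - t != 0 ->
  - t^-1 / (1 - t^-1) = 1 + t / (1 - t).
Proof.
move=> t0 nz; have nz' : t - 1 != 0 by rewrite -oppr_eq0 opprB.
by field; rewrite t0 nz nz'.
Qed.

Lemma exp_sub_div (L : fieldType) (t : L) k n : t != 0 -> (k <= n)%N ->
  t ^+ (n - k) / t ^+ n = (t ^+ k)^-1.
Proof.
move=> t0 kn; rewrite -[X in _ / t ^+ X](subnK kn) exprD invfM mulrA divff ?mul1r //.
by rewrite expf_neq0.
Qed.

Section WeightValues.
Variables (F : fieldType) (y : F) (a : nat).
Hypothesis y_neq0 : y != 0.
Hypothesis yX_neq1 : forall k, (0 < k)%N -> y ^+ k != 1.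
Notation lam k := (y ^+ k / (1 - y ^+ k)).

(** Together with [frac_wt0_below]: the degrees [a + k] and [a - k] share one Lambert value with
    opposite signs, so only the difference of their coefficients can be seen. *)
Lemma frac_wt0_above k : frac_wt0 y a (a + k) = - lam k.
Proof.
have E : wt0 y a (a + k) = - y ^+ k.
  by rewrite /wt0 exprD mulrAC divff ?mul1r // expf_neq0.
by rewrite /frac_wt0 E mulNr.
Qed.

Lemma frac_wt0_below k : (0 < k)%N -> (k <= a)%N ->
  frac_wt0 y a (a - k) = 1 + lam k.
Proof.
move=> k0 ka; rewrite /frac_wt0 /wt0 exp_sub_div // div_inv_sub1 ?expf_neq0 //.
by rewrite subr_eq0 eq_sym yX_neq1.
Qed.
End WeightValues.

Section Reflection.
Variables (F : fieldType) (a : nat).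
Notation y := (eps F).
Notation lam k := (y ^+ k / (1 - y ^+ k)).

(** In the relation, each Lambert value has the coefficient at [a - k] minus the one at [a + k], and
    by [lambert_independent] this is zero. For [k > a] there is no index [a - k]. *)
Lemma lambert_reflection B (al : nat -> F) : (a < B)%N ->
  \sum_(j < B) cst F (al j) * frac_wt0 y a j = 0 ->
  forall k, (0 < k)%N -> (a + k < B)%N ->
  al (a + k)%N = if (k <= a)%N then al (a - k)%N else 0.
Proof.
move=> aB E.
(* [g k] is the coefficient of the Lambert value of exponent [k.+1]; [c] below collects the
   constants 1 coming from the indices under [a]. *)
pose g k := \sum_(j < B) al j * ((j + k.+1 == a)%N%:R - (j == a + k.+1 :> nat)%N%:R).
pose c := \sum_(j < B) al j * (j < a)%N%:R.
have rel : cst F c + \sum_(k < B) cst F (g k) * lam k.+1 = 0.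
  rewrite -[RHS]E /c rmorph_sum /=.
  under [X in _ + X]eq_bigr do rewrite /g rmorph_sum /= mulr_suml.
  rewrite exchange_big -big_split /=; apply: eq_bigr => j _.
  rewrite !rmorphM rmorph_nat.
  under eq_bigr do rewrite rmorphM rmorphB !rmorph_nat -mulrA.
  rewrite -mulr_sumr -mulrDr; congr (_ * _).
  have single (k0 : nat) (kB : (k0 < B)%N) (G : nat -> (ratfun F)) :
    \sum_(k < B) (if k == k0 :> nat then G k else 0) = G k0.
    by rewrite (bigD1 (Ordinal kB)) //= eqxx big1 ?addr0 // => i; rewrite -val_eqE /= => /negPf ->.
  case: (ltngtP j a) => ja /=.
  - have E' : (a - (a - j).-1.+1 = j)%N by lia.
    rewrite -[in RHS]E' frac_wt0_below ?eps_neq0 //; [|exact: epsX_neq1|lia]; congr (1 + _).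
    rewrite -(single (a - j).-1 _ (fun k => lam k.+1)); last by lia.
    apply: eq_bigr => k _.
    have -> : (j + k.+1 == a)%N = (k == (a - j).-1 :> nat) by lia.
    have -> : (j == a + k.+1 :> nat)%N = false by lia.
    by rewrite subr0; case: ifP => _; rewrite ?mul1r ?mul0r.
  - have E' : (a + (j - a).-1.+1 = j)%N by lia.
    rewrite -[in RHS]E' frac_wt0_above ?eps_neq0 // add0r.
    have jB := ltn_ord j.
    rewrite -(single (j - a).-1 _ (fun k => lam k.+1)) -?sumrN; last by lia.
    apply: eq_bigr => k _.
    have -> : (j + k.+1 == a)%N = false by lia.
    have -> : (j == a + k.+1 :> nat)%N = (k == (j - a).-1 :> nat) by lia.
    by rewrite sub0r; case: ifP => _; rewrite ?mulN1r ?oppr0 ?mul0r.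
  (* At [j = a] the convention [frac_wt0 a = 0] leaves no contribution. *)
  - rewrite ja frac_wt0_pole ?eps_neq0 // add0r big1 // => k _.
    have -> : (a + k.+1 == a)%N = false by lia.
    have -> : (a == a + k.+1 :> nat)%N = false by lia.
    by rewrite subrr mul0r.
case=> // k _ akB; have kB : (k < B)%N by lia.
have := lambert_independent rel kB; rewrite /g.
under eq_bigr do rewrite mulrBr; rewrite sumrB => /eqP; rewrite subr_eq0 => /eqP.
rewrite [RHS](bigD1 (Ordinal akB)) //= eqxx mulr1 [X in _ = _ + X]big1 ?addr0; last first.
  by move=> i; rewrite -val_eqE /= => /negPf ->; rewrite mulr0.
move=> <-; case: leqP => ka; last first.
  have kB' : (a - k.+1 < B)%N by lia.
  rewrite (bigD1 (Ordinal kB')) //= subnK // eqxx mulr1 big1 ?addr0 // => i.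
  rewrite -val_eqE /= => ik; have /negPf -> : (i + k.+1 != a)%N by lia.
  by rewrite mulr0.
rewrite big1 // => i _; have /negPf -> : (i + k.+1 != a)%N by lia.
by rewrite mulr0.
Qed.
End Reflection.

(** * Recovery of degree counts from weighted sums *)

Section CountsDetermined.
Notation Qs := (ratfun rat).
Notation s := (eps rat).

Lemma cst_natB (m n : nat) : cst _ (cst rat (m%:R - n%:R)) = m%:R - n%:R.
Proof. by rewrite !rmorphB !rmorph_nat. Qed.

Lemma natrB_eq0 (m n : nat) : m%:R - n%:R = 0 :> rat -> m = n.
Proof. by move/eqP; rewrite subr_eq0 eqr_nat => /eqP. Qed.

(* Induction on the smaller degree: the pole at [a] only sees the difference
   between the entries at [a + k] and [a - k]. *)
Lemma edge_counts_determined B (m m' : nat -> nat -> nat) :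
  (forall i j, m i j = m j i) -> (forall i j, m' i j = m' j i) ->
  (forall a, \sum_(i < B) \sum_(j < B) (m i j)%:R * (frac_wt s a i * frac_wt s a j) =
             \sum_(i < B) \sum_(j < B) (m' i j)%:R * (frac_wt s a i * frac_wt s a j)) ->
  forall i j, (i < B)%N -> (j < B)%N -> m i j = m' i j.
Proof.
move=> msym msym' E.
have pole a : (a < B)%N -> m a a = m' a a /\ forall k, (0 < k)%N -> (a + k < B)%N ->
    (forall i, (i < a)%N -> m i a = m' i a) -> m a (a + k)%N = m' a (a + k)%N.
  move=> aB.
  pose d i j := cst rat ((m i j)%:R - (m' i j)%:R).
  have [|d0 dsum] := @pole2 _ s a (eps_neq0 _) (@epsX_neq1 _) B d aB.
    have := E a; move/eqP; rewrite -subr_eq0 -sumrB => /eqP Z.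
    rewrite -[RHS]Z; apply: eq_bigr => i _; rewrite -sumrB; apply: eq_bigr => j _.
    by rewrite /d cst_natB mulrBl.
  split; first by apply: natrB_eq0; apply/eqP; rewrite -(fmorph_eq0 (cst rat)) -/(d a a) d0.
  move=> k k0 akB low.
  (* By symmetry [delta a j + delta j a] is twice the difference of the counts. *)
  pose al j := ((m a j)%:R - (m' a j)%:R : rat) *+ 2.
  have := @lambert_reflection _ a B al aB.
  rewrite (_ : \sum_(j < B) _ = 0); last first.
    rewrite -[RHS]dsum; apply: eq_bigr => j _; congr (_ * _).
    by rewrite /d [m j a]msym [m' j a]msym' -rmorphD -mulr2n.
  move=> /(_ erefl k k0 akB); have -> : (if (k <= a)%N then al (a - k)%N else 0) = 0.
    case: ifP => // ka; rewrite /al [m a _]msym [m' a _]msym' low ?subrr //.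
    by rewrite ltn_subrL k0 (leq_trans k0 ka).
  by move/eqP; rewrite mulrn_eq0 /= => /eqP/natrB_eq0.
elim/ltn_ind => i IH j iB jB; case: (ltngtP i j) => ij.
- by rewrite -(subnKC (ltnW ij)); apply: (pole i iB).2;
  rewrite ?subn_gt0 ?subnKC ?(ltnW ij) // => l li; apply: IH => //; apply: ltn_trans li iB.
- by rewrite msym msym'; apply: IH.
- by rewrite -ij; apply: (pole i iB).1.
Qed.

(** The mirror image of [b] in [a] is [2 * a - b]. When [b >= 2 * a] it is absent, or it is 0 and
    the counts there are assumed equal. *)
Lemma path3_counts_determined B (m m' : nat -> nat -> nat -> nat) :
  (forall i j k, m i j k = m k j i) -> (forall i j k, m' i j k = m' k j i) ->
  (forall a, \sum_(i < B) \sum_(j < B) \sum_(k < B)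
      (m i j k)%:R * (frac_wt s a i * mid_wt s a j * frac_wt s a k) =
    \sum_(i < B) \sum_(j < B) \sum_(k < B)
      (m' i j k)%:R * (frac_wt s a i * mid_wt s a j * frac_wt s a k)) ->
  forall a, (a < B)%N -> m a a a = m' a a a /\
    forall b, (2 * a <= b < B)%N -> (a < b)%N -> m a a 0%N = m' a a 0%N ->
      m a a b = m' a a b.
Proof.
move=> msym msym' E a aB.
pose d i j k := cst rat ((m i j k)%:R - (m' i j k)%:R).
have [|d0 dsum] := @pole3 _ s a (eps_neq0 _) (@epsX_neq1 _) B d aB.
  have := E a; move/eqP; rewrite -subr_eq0 -sumrB => /eqP Z.
  rewrite -[RHS]Z; apply: eq_bigr => i _; rewrite -sumrB; apply: eq_bigr => j _.
  by rewrite -sumrB; apply: eq_bigr => k _; rewrite /d cst_natB mulrBl.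
split; first by apply: natrB_eq0; apply/eqP; rewrite -(fmorph_eq0 (cst rat)) -/(d a a a) d0.
move=> b /andP[ab bB] lt_ab m0.
pose al j := ((m a a j)%:R - (m' a a j)%:R : rat) *+ 2.
have k0 : (0 < b - a)%N by rewrite subn_gt0.
have := @lambert_reflection _ a B al aB.
rewrite (_ : \sum_(j < B) _ = 0); last first.
  rewrite -[RHS]dsum; apply: eq_bigr => j _; congr (_ * _).
  by rewrite /d [m j a a]msym [m' j a a]msym' -rmorphD -mulr2n.
move=> /(_ erefl (b - a)%N k0); rewrite (subnKC (ltnW lt_ab)) => /(_ bB).
have -> : (if (b - a <= a)%N then al (a - (b - a))%N else 0) = 0.
  (* Here [b = 2 * a], the only case with a mirror index. *)
  case: ifP => // ka; have -> : (a - (b - a) = 0)%N by lia.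
  by rewrite /al m0 subrr.
by move/eqP; rewrite mulrn_eq0 /= => /eqP/natrB_eq0.
Qed.
End CountsDetermined.

Local Close Scope ring_scope.

(** * Embeddings and their images *)

Section Embeddings.
Variables (D : sgraph) (a : D -> nat).

(** Adjacency is preserved but need not be reflected: an image is a subgraph with its own edges, not
    an induced one. *)
Definition embs (T : sgraph) : {set {ffun D -> T}} :=
  [set f : {ffun D -> T} | [&& injectiveb f,
     [forall u, forall v, adj u v ==> adj (f u) (f v)] &
     [forall u, a u == deg (f u)]]].

Lemma embsP (T : sgraph) (f : {ffun D -> T}) :
  reflect [/\ injective f, forall u v, adj u v -> adj (f u) (f v) &
              forall u, a u = deg (f u)] (f \in embs T).
Proof.
rewrite inE; apply: (iffP and3P) => [[/injectiveP fI /forallP fA /forallP fD]|[fI fA fD]].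
  split=> // [u v uv|u]; last exact/eqP.
  by have /forallP/(_ v)/implyP/(_ uv) := fA u.
split; first exact/injectiveP.
  by apply/forallP => u; apply/forallP => v; apply/implyP/fA.
by apply/forallP => u; apply/eqP.
Qed.

Definition auts : {set {ffun D -> D}} :=
  [set s : {ffun D -> D} | [&& injectiveb s,
     [forall u, forall v, adj (s u) (s v) == adj u v] &
     [forall u, a (s u) == a u]]].

Lemma autsP (s : {ffun D -> D}) :
  reflect [/\ injective s, forall u v, adj (s u) (s v) = adj u v &
              forall u, a (s u) = a u] (s \in auts).
Proof.
rewrite inE; apply: (iffP and3P) => [[/injectiveP fI /forallP fA /forallP fD]|[fI fA fD]].
  split=> // [u v|u]; last exact/eqP.
  by have /forallP/(_ v)/eqP := fA u.
split; first exact/injectiveP.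
  by apply/forallP => u; apply/forallP => v; apply/eqP.
by apply/forallP => u; apply/eqP.
Qed.

Lemma auts_gt0 : 0 < #|auts|.
Proof.
apply/card_gt0P; exists [ffun u => u]; apply/autsP.
by split=> [u v|u v|u]; rewrite !ffunE.
Qed.

Variable T : sgraph.

Definition emb_image (f : {ffun D -> T}) : subg_data T :=
  ([set f u | u : D], [set [set f p.1; f p.2] | p : D * D & adj p.1 p.2]).

Lemma set2_inj (x y x' y' : T) : [set x; y] = [set x'; y'] ->
  (x = x' /\ y = y') \/ (x = y' /\ y = x').
Proof.
move=> E.
have: x \in [set x'; y'] by rewrite -E set21.
have: y \in [set x'; y'] by rewrite -E set22.
have: x' \in [set x; y] by rewrite E set21.
have: y' \in [set x; y] by rewrite E set22.
by rewrite !inE; do 4![case/orP => /eqP ?]; subst; auto.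
Qed.

Lemma subg_adjE (H : subg_data T) (x y : subg H) :
  adj x y = (val x != val y) && ([set val x; val y] \in H.2).
Proof. by []. Qed.

Lemma emb_image_edge (f : {ffun D -> T}) u v : injective f ->
  ([set f u; f v] \in (emb_image f).2) = adj u v.
Proof.
move=> fI; apply/imsetP/idP => [[[u' v']]|uv].
  rewrite inE /= => uv' /set2_inj[][/fI-> /fI->] //.
  by rewrite adj_sym.
by exists (u, v); rewrite ?inE.
Qed.

Lemma is_tree_iso (G H : sgraph) (f : {ffun G -> H}) :
  is_iso f -> is_tree G -> is_tree H.
Proof.
case/and3P=> /injectiveP fI /forallP fS /forallP fA /and3P[G0 /forallP Gc /acyclicP Ga].
have adjf u v : adj (f u) (f v) = adj u v by have /forallP/(_ v)/eqP := fA u.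
pose g y := iinv (fS y); have fg y : f (g y) = y by rewrite f_iinv.
have gf u : g (f u) = u by apply: fI; rewrite fg.
apply/and3P; split.
- by case/card_gt0P: G0 => u _; apply/card_gt0P; exists (f u).
- apply/forallP => x; apply/forallP => y; rewrite -[x]fg -[y]fg.
  have /forallP/(_ (g y))/connectP[p pth ->] := Gc (g x).
  apply/connectP; exists (map f p); last by rewrite last_map.
  by rewrite path_map; apply: sub_path pth => u v /=; rewrite adjf.
- apply/acyclicP => c /andP[cyc uc]; rewrite -(size_map g); apply: Ga.
  apply/andP; split; last by rewrite map_inj_uniq // => x y E; rewrite -[x]fg E fg.
  by rewrite (cycle_map) //; apply: sub_cycle cyc => u v /=; rewrite -adjf !fg.
Qed.

Hypothesis treeD : is_tree D.

Definition emb_subgraphs : {set subg_data T} :=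
  [set H : subg_data T | [&& is_subgraph H, is_tree (subg H) &
          [exists phi : {ffun D -> subg H}, is_deg_embedding a phi]]].

Lemma emb_image_in f : f \in embs T -> emb_image f \in emb_subgraphs.
Proof.
case/embsP => fI fA fD; rewrite inE.
have fin u : f u \in (emb_image f).1 by apply: imset_f.
pose phi : {ffun D -> subg (emb_image f)} := [ffun u => Sub (f u) (fin u)].
have phiE u : val (phi u) = f u by rewrite ffunE.
have iso : is_iso phi.
  apply/and3P; split.
  - by apply/injectiveP => u v /(congr1 val); rewrite !phiE => /fI.
  - apply/forallP => y; have /imsetP[u _ yu] := valP y.
    by apply/codomP; exists u; apply: val_inj; rewrite phiE.
  - apply/forallP => u; apply/forallP => v; apply/eqP.
    rewrite subg_adjE !phiE emb_image_edge // (inj_eq fI).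
    by case uv: (adj u v); rewrite ?andbF // andbT; apply/eqP => E; rewrite E adj_irrefl in uv.
apply/and3P; split.
- apply/andP; split.
    apply/subsetP => e /imsetP[[u v]]; rewrite inE /= => uv ->.
    by apply/imsetP; exists (f u, f v); rewrite ?inE //= fA.
  apply/forallP => e; apply/implyP => /imsetP[[u v] _ ->] /=.
  by apply/subsetP => x; rewrite !inE => /orP[]/eqP->.
- exact: is_tree_iso iso treeD.
- apply/existsP; exists phi; rewrite /is_deg_embedding iso /=.
  by apply/forallP => u; rewrite phiE fD.
Qed.

Lemma emb_subgraph_image H : H \in emb_subgraphs ->
  exists2 f, f \in embs T & emb_image f = H.
Proof.
rewrite inE => /and3P[/andP[/subsetP Hsub /forallP Hin] _ /existsP[phi]].
case/andP=> /and3P[/injectiveP pI /forallP pS /forallP pA] /forallP pD.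
have adjp u v : adj (phi u) (phi v) = adj u v by have /forallP/(_ v)/eqP := pA u.
pose f : {ffun D -> T} := [ffun u => val (phi u)].
have fE u : f u = val (phi u) by rewrite ffunE.
exists f.
  apply/embsP; split=> [u v|u v|u]; rewrite !fE; first by move/val_inj/pI.
    rewrite -adjp subg_adjE => /andP[_ /Hsub/imsetP[[x y]]]; rewrite inE /= => xy.
    by move/set2_inj => [][-> ->] //; rewrite adj_sym.
  exact/eqP.
case: H phi Hsub Hin pI pS pA pD adjp f fE => V E phi Hsub Hin pI pS pA pD adjp f fE.
congr (_, _); apply/setP => z; apply/imsetP/idP.
- by case=> u _ ->; rewrite fE; apply: valP.
- by move=> zV; have /codomP[u zu] := pS (Sub z zV); exists u; rewrite // fE -zu.
- case=> -[u v]; rewrite inE /= => uv ->; rewrite !fE.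
  by move: uv; rewrite -adjp subg_adjE => /andP[].
- move=> zE; have /imsetP[[x y]] := Hsub _ zE; rewrite inE /= => xy zxy.
  have /implyP/(_ zE)/subsetP zV := Hin z.
  have xV : x \in V by apply: zV; rewrite zxy set21.
  have yV : y \in V by apply: zV; rewrite zxy set22.
  have /codomP[u xu] := pS (Sub x xV); have /codomP[v yv] := pS (Sub y yV).
  exists (u, v); last by rewrite /= !fE -xu -yv.
  rewrite inE /= -adjp -xu -yv subg_adjE /= -zxy zE andbT.
  by apply: contraTneq xy => ->; rewrite adj_irrefl.
Qed.

(** Two embeddings with the same image differ by a unique label-preserving automorphism of [D]. *)
Lemma card_emb_fiber f : f \in embs T ->
  #|[set f' in embs T | emb_image f' == emb_image f]| = #|auts|.
Proof.
move=> fE; have /embsP[fI fA fD] := fE.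
pose h (s : {ffun D -> D}) : {ffun D -> T} := [ffun u => f (s u)].
have hI : injective h.
  by move=> s s' /ffunP E; apply/ffunP => u; have := E u; rewrite !ffunE => /fI.
rewrite -(card_imset _ hI); apply: eq_card => f'; apply/idP/imsetP.
  rewrite inE => /andP[/embsP[fI' fA' fD'] /eqP img].
  have pre u : exists w, f w == f' u.
    have : f' u \in (emb_image f').1 by apply: imset_f.
    by rewrite img => /imsetP[w _ ->]; exists w.
  (* [s] is [f'] followed by the inverse of [f], defined because the images agree. *)
  pose s : {ffun D -> D} := [ffun u => xchoose (pre u)].
  have fs u : f (s u) = f' u by rewrite ffunE; apply/eqP/(xchooseP (pre u)).
  exists s; last by apply/ffunP => u; rewrite ffunE fs.
  apply/autsP; split=> [u v E|u v|u].
  - by apply: fI'; rewrite -!fs E.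
  - by rewrite -(emb_image_edge _ _ fI) !fs -img emb_image_edge.
  - by rewrite fD fs -fD'.
case=> s /autsP[sI sA sD] ->; rewrite inE; apply/andP; split.
  apply/embsP; split=> [u v|u v uv|u]; rewrite !ffunE; first by move/fI/sI.
    by apply: fA; rewrite sA.
  by rewrite -fD sD.
have sS u : exists v, u = s v by exists (invF sI u); rewrite f_invF.
apply/eqP; congr (_, _); apply/setP => z; apply/imsetP/imsetP.
- by case=> u _ ->; exists (s u); rewrite ?ffunE.
- by case=> u _ ->; have [v ->] := sS u; exists v; rewrite ?ffunE.
- case=> -[u v]; rewrite inE /= => uv ->; exists (s u, s v); rewrite ?inE /= ?sA //.
  by rewrite !ffunE.
- case=> -[u v]; have [u' ->] := sS u; have [v' ->] := sS v.
  rewrite inE /= sA => uv ->; exists (u', v'); rewrite ?inE //=.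
  by rewrite !ffunE.
Qed.

Lemma card_embs : #|embs T| = deg_emb_num a T * #|auts|.
Proof.
rewrite -sum1_card (partition_big emb_image (mem emb_subgraphs)) /=; last exact: emb_image_in.
rewrite (eq_bigr (fun=> #|auts|)); first by rewrite sum_nat_const.
move=> H /emb_subgraph_image[f fE <-]; rewrite -(card_emb_fiber fE) -sum1_card.
by apply: eq_bigl => f'; rewrite inE.
Qed.
End Embeddings.

(** The number of automorphisms depends on [D] and its labels alone and is positive, so it
    cancels. *)
Lemma deg_emb_num_eq (D : sgraph) (a : D -> nat) (T T' : sgraph) : is_tree D ->
  #|embs a T| = #|embs a T'| -> deg_emb_num a T = deg_emb_num a T'.
Proof.
move=> treeD; rewrite !card_embs // => /eqP.
by rewrite eqn_pmul2r ?auts_gt0 // => /eqP.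
Qed.

(** * Sums over vertex sets *)

Local Open Scope ring_scope.

Definition gdp_exponents (T : sgraph) (A : {set T}) : nat * nat * nat :=
  (#|A|, d_out A, e_in A).

Definition mono3 (t : nat * nat * nat) : 'X_{1..3} :=
  [multinom tnth [tuple t.1.1; t.1.2; t.2] i | i < 3].

Lemma mono3_inj : injective mono3.
Proof.
move=> [[n d] e] [[n' d'] e'] /mnmP E.
have := E (@Ordinal 3 0 isT); have := E (@Ordinal 3 1 isT); have := E (@Ordinal 3 2 isT).
by rewrite !mnmE !(tnth_nth 0%N) /= => -> -> ->.
Qed.

Lemma gdpE (T : sgraph) : gdp T = \sum_(A : {set T}) 'X_[mono3 (gdp_exponents A)].
Proof.
apply: eq_bigr => A _; rewrite !mpolyXn -!mpolyXD; congr 'X_[_]; apply/mnmP => i.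
rewrite !mnmDE !mulmnE !mnmE (tnth_nth 0%N) -!val_eqE /=.
by case: i => [[|[|[|i]]] ilt] //=; rewrite ?mul1n ?mul0n ?addn0 ?add0n.
Qed.

(** Distinct triples give distinct monomials, so the coefficients are the multiplicities of the
    triples. *)
Lemma gdp_perm (T T' : sgraph) : gdp T = gdp T' ->
  perm_eq [seq gdp_exponents A | A <- index_enum {set T}]
          [seq gdp_exponents A | A <- index_enum {set T'}].
Proof.
move=> E; apply/allP => t _ /=; apply/eqP.
have coef (G : sgraph) :
  (gdp G)@_(mono3 t) = (count_mem t [seq gdp_exponents A | A <- index_enum {set G}])%:R.
  rewrite gdpE raddf_sum /= count_map -sum1_count natr_sum [RHS]big_mkcond /=.
  apply: eq_bigr => A _; rewrite mcoeffX (inj_eq mono3_inj).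
  by case: (_ == _).
by have := congr1 (mcoeff (mono3 t)) E; rewrite !coef => /eqP; rewrite eqr_nat => /eqP.
Qed.

Lemma gdp_sum_eq (T T' : sgraph) (V : nmodType) (phi : nat -> nat -> nat -> V) :
  gdp T = gdp T' ->
  \sum_(A : {set T}) phi #|A| (d_out A) (e_in A) =
  \sum_(A : {set T'}) phi #|A| (d_out A) (e_in A).
Proof.
move=> /gdp_perm E; pose psi t := phi t.1.1 t.1.2 t.2.
have aux (G : sgraph) : \sum_(A : {set G}) phi #|A| (d_out A) (e_in A) =
   \sum_(t <- [seq gdp_exponents A | A <- index_enum {set G}]) psi t.
  by rewrite big_map.
by rewrite !aux (perm_big _ E).
Qed.

Section DegreeSum.
Local Open Scope nat_scope.
Variable T : sgraph.
Implicit Types (A : {set T}) (e : {set T}).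

Lemma edgesP e : reflect (exists x y, adj x y /\ e = [set x; y]) (e \in edges T).
Proof.
apply: (iffP imsetP) => [[[x y]]|[x [y [xy ->]]]]; last by exists (x, y); rewrite ?inE.
by rewrite inE /= => xy ->; exists x, y.
Qed.

Lemma adj_neq (x y : T) : adj x y -> x != y.
Proof. by apply: contraTneq => ->; rewrite adj_irrefl. Qed.

Lemma edge_card e : e \in edges T -> #|e| = 2.
Proof. by case/edgesP => x [y [xy ->]]; rewrite cards2 adj_neq. Qed.

Lemma mem_edges (x y : T) : x != y -> ([set x; y] \in edges T) = adj x y.
Proof.
move=> xy; apply/edgesP/idP => [[x' [y' [xy' /set2_inj]]]|xy']; last by exists x, y.
by case=> [][-> ->] //; rewrite adj_sym.
Qed.

(** Double counting: an ordered adjacent pair is an edge with one of its ends distinguished. *)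
Lemma sum_adj_edges (P : pred {set T}) (Q : pred T) :
  \sum_(x | Q x) \sum_(y | adj x y && P [set x; y]) 1 =
  \sum_(e in edges T | P e) #|[set x in e | Q x]|.
Proof.
under [RHS]eq_bigr do rewrite -sum1_card.
rewrite [RHS](exchange_big_dep Q) /=; last by move=> e x _; rewrite inE => /andP[].
apply: eq_bigr => x Qx; rewrite !sum1_card.
rewrite -(card_in_imset (f := fun y => [set x; y])); last first.
  move=> y y' /andP[xy _] /andP[xy' _] /set2_inj[][] // <- yx.
  by rewrite yx adj_irrefl in xy.
apply: eq_card => e; apply/imsetP/idP => [[y /andP[xy Pe] ->]|].
  by rewrite unfold_in !inE eqxx Qx Pe (mem_edges (adj_neq xy)) xy.
rewrite unfold_in => /andP[/andP[/edgesP[u [v [uv ->]]] Pe]].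
rewrite !inE => /andP[/orP[]/eqP xu _].
  by exists v; rewrite ?unfold_in xu ?uv.
by exists u; rewrite xu 1?setUC // unfold_in adj_sym uv setUC.
Qed.

(** An edge inside [A] is met from both ends, a boundary edge from one. This trades [d_out A] for a
    sum over vertices, whose exponential is a product weight. *)
Lemma sum_deg A : \sum_(x in A) deg x = d_out A + 2 * e_in A.
Proof.
transitivity (\sum_(x in A) \sum_(y | adj x y && predT [set x; y]) 1)%N.
  apply: eq_bigr => x _; rewrite sum1_card; apply: eq_card => y.
  by rewrite inE unfold_in /= andbT.
rewrite sum_adj_edges /d_out /e_in -!sum1_card big_distrr /=.
under eq_bigl do rewrite andbT.
under [X in _ = X + _]eq_bigl do rewrite inE.
under [X in _ = _ + X]eq_bigl do rewrite inE.
rewrite !big_mkcondr -big_split /=; apply: eq_bigr => e eE.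
have -> : [set x in e | x \in A] = e :&: A by apply/setP => x; rewrite !inE.
have := subset_leq_card (subsetIl e A); rewrite (edge_card eE).
have -> : (e \subset A) = (#|e :&: A| == 2).
  rewrite -(edge_card eE) (subset_leqif_cards (subsetIl e A)).2.
  exact: sameP setIidPl eqP.
by case: #|_| => [|[|[|]]].
Qed.

Lemma double_e_in A :
  2 * e_in A = \sum_(x : T) \sum_(y : T) (adj x y && ((x \in A) && (y \in A))).
Proof.
under eq_bigr do rewrite -big_mkcond.
transitivity (\sum_(x | predT x) \sum_(y | adj x y && ([set x; y] \subset A)) 1)%N; last first.
  apply: eq_bigr => x _; apply: eq_bigl => y.
  by congr (_ && _); rewrite subUset !sub1set.
rewrite (sum_adj_edges (fun e => e \subset A)) /e_in -sum1_card big_distrr /=.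
apply: eq_big => [e|e]; rewrite inE // => /andP[eE _].
by rewrite muln1 -(edge_card eE); apply: eq_card => x; rewrite !inE andbT.
Qed.

End DegreeSum.

Lemma gdp_degsum_eq (T T' : sgraph) (V : nmodType) (phi : nat -> nat -> nat -> V) :
  gdp T = gdp T' ->
  \sum_(A : {set T}) phi #|A| (\sum_(x in A) deg x)%N (e_in A) =
  \sum_(A : {set T'}) phi #|A| (\sum_(x in A) deg x)%N (e_in A).
Proof.
move=> E; under eq_bigr do rewrite sum_deg; under [RHS]eq_bigr do rewrite sum_deg.
exact: gdp_sum_eq (fun n d e => phi n (d + 2 * e)%N e) E.
Qed.

Local Close Scope ring_scope.

(** * Product weights on vertex sets and their cumulants *)

Local Open Scope ring_scope.

Lemma sum_subsets (R : comNzRingType) (I : finType) (X : {set I}) (g : I -> R) :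
  \sum_(A : {set I} | A \subset X) \prod_(i in A) g i = \prod_(i in X) (1 + g i).
Proof.
rewrite [RHS]big_mkcond /=.
transitivity (\prod_i ((i \in X)%:R * g i + 1)); last first.
  by apply: eq_bigr => i _; case: ifP => _; rewrite ?mul1r ?mul0r 1?addrC ?addr0.
rewrite bigA_distr big_mkcond; apply: eq_bigr => A _; rewrite -big_mkcond /=.
case: ifP => [/subsetP sAX|/negbT/subsetPn[i iA iX]].
  by apply: eq_bigr => i /sAX ->; rewrite mul1r.
by rewrite (bigD1 i) //= (negPf iX) !mul0r.
Qed.

Lemma sum_delta (R : pzRingType) (I : finType) (i : I) (G : I -> R) :
  \sum_j (i == j)%:R * G j = G i.
Proof.
rewrite (bigD1 i) //= eqxx mul1r big1 ?addr0 // => j; rewrite eq_sym => /negPf ->.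
by rewrite mul0r.
Qed.

Section WeightedSums.
Variables (K : fieldType) (T : sgraph) (p : T -> K).
Hypothesis p_neq : forall v, 1 + p v != 0.
Notation f v := (p v / (1 + p v)).
Notation P := (\prod_v (1 + p v)).

(** A vertex of [S] contributes [p v] and any other [1 + p v]; dividing by the full product leaves
    [f v] on [S]. *)
Lemma sum_supersets (S : {set T}) :
  \sum_(A : {set T} | S \subset A) \prod_(v in A) p v = P * \prod_(v in S) f v.
Proof.
rewrite [X in _ * X]big_mkcond -big_split /=.
transitivity (\prod_v (p v + (v \notin S)%:R)); last first.
  apply: eq_bigr => v _; case: ifP => _ /=; last by rewrite mulr1 addrC.
  by rewrite addr0 mulrC divfK.
rewrite bigA_distr big_mkcond; apply: eq_bigr => A _.
case: ifP => [/subsetP sSA|/negbT/subsetPn[v vS vA]].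
  rewrite big_mkcond; apply: eq_bigr => v _; case: ifP => // vA.
  by case: (boolP (v \in S)) => // /sSA; rewrite vA.
by rewrite (bigD1 v) //= (negPf vA) vS mul0r.
Qed.

Lemma sum_ind_supersets (S : {set T}) :
  \sum_(A : {set T}) (S \subset A)%:R * \prod_(v in A) p v = P * \prod_(v in S) f v.
Proof.
rewrite -sum_supersets [RHS]big_mkcond; apply: eq_bigr => A _.
by case: ifP => _; rewrite ?mul1r ?mul0r.
Qed.

(** After normalisation the vertices enter [A] independently, [v] with weight [f v]; this is the
    weight of the event that [A] contains [S]. *)
Definition joint (S : {set T}) : K := \prod_(v in S) f v.

Lemma joint2 x y : x != y -> joint [set x; y] = f x * f y.
Proof. by move=> xy; rewrite /joint big_setU1 ?inE // big_set1. Qed.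

(** First moment, by linearity. Counting ordered pairs, hence [2 * e_in A], avoids sums over
    edges. *)
Lemma sum_e_in1 : \sum_(A : {set T}) (2 * e_in A)%N%:R * \prod_(v in A) p v =
  P * \sum_x \sum_y (adj x y)%:R * (f x * f y).
Proof.
under [LHS]eq_bigr => A _ do rewrite double_e_in natr_sum mulr_suml.
rewrite [LHS]exchange_big mulr_sumr; apply: eq_bigr => x _.
under [LHS]eq_bigr => A _ do rewrite natr_sum mulr_suml.
rewrite [LHS]exchange_big mulr_sumr; apply: eq_bigr => y _.
have [xy|nxy] := boolP (adj x y); last by rewrite mul0r mulr0 big1 // => A _; rewrite mul0r.
rewrite mul1r -(joint2 (adj_neq xy)) -sum_ind_supersets; apply: eq_bigr => A _.
by rewrite subUset !sub1set.
Qed.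

Lemma sum_e_in2 : \sum_(A : {set T}) ((2 * e_in A) ^ 2)%N%:R * \prod_(v in A) p v =
  P * \sum_x \sum_y \sum_u \sum_v
        ((adj x y)%:R * (adj u v)%:R) * joint ([set x; y] :|: [set u; v]).
Proof.
have sq A : ((2 * e_in A) ^ 2)%N%:R = \sum_(x : T) \sum_(y : T) \sum_(u : T) \sum_(v : T)
    ((adj x y)%:R * (adj u v)%:R) * ([set x; y] :|: [set u; v] \subset A)%:R :> K.
  rewrite -mulnn double_e_in natrM natr_sum mulr_suml; apply: eq_bigr => x _.
  rewrite natr_sum mulr_suml; apply: eq_bigr => y _.
  rewrite mulr_sumr; apply: eq_bigr => u _.
  rewrite natr_sum mulr_sumr; apply: eq_bigr => v _.
  by rewrite -!natrM !mulnb !subUset !sub1set; congr (nat_of_bool _)%:R; do !case: (_ \in _);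
    rewrite ?andbT ?andbF //.
under [LHS]eq_bigr => A _ do rewrite sq mulr_suml.
rewrite [LHS]exchange_big mulr_sumr; apply: eq_bigr => x _.
under [LHS]eq_bigr => A _ do rewrite mulr_suml.
rewrite [LHS]exchange_big mulr_sumr; apply: eq_bigr => y _.
under [LHS]eq_bigr => A _ do rewrite mulr_suml.
rewrite [LHS]exchange_big mulr_sumr; apply: eq_bigr => u _.
under [LHS]eq_bigr => A _ do rewrite mulr_suml.
rewrite [LHS]exchange_big mulr_sumr; apply: eq_bigr => v _.
under [LHS]eq_bigr => A _ do rewrite -mulrA.
by rewrite -mulr_sumr sum_ind_supersets mulrCA.
Qed.

(** The power of [1 + w] expands over the sets [F] of edges inside [A], and these are the [F] with
    [cover F] inside [A]. *)
Lemma sum_e_in_exp (w : K) :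
  \sum_(A : {set T}) (1 + w) ^+ e_in A * \prod_(v in A) p v =
  P * \sum_(F : {set {set T}} | F \subset edges T) w ^+ #|F| * joint (cover F).
Proof.
have ex A : (1 + w) ^+ e_in A =
  \sum_(F : {set {set T}} | F \subset edges T) w ^+ #|F| * (cover F \subset A)%:R.
  rewrite /e_in -prodr_const -sum_subsets.
  rewrite big_mkcond [RHS]big_mkcond; apply: eq_bigr => F _; rewrite prodr_const.
  have -> : (F \subset [set e in edges T | e \subset A]) =
            (F \subset edges T) && (cover F \subset A).
    apply/subsetP/andP => [FE|[/subsetP FE /bigcupsP FA] e eF]; last by rewrite inE FE ?FA.
    split; first by apply/subsetP => e /FE; rewrite inE => /andP[].
    by apply/bigcupsP => e /FE; rewrite inE => /andP[].
  by case: (_ \subset _) => //=; case: (_ \subset _); rewrite ?mulr1 ?mulr0.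
under [LHS]eq_bigr => A _ do rewrite ex mulr_suml.
rewrite [LHS]exchange_big mulr_sumr; apply: eq_bigr => F _.
under [LHS]eq_bigr => A _ do rewrite -mulrA.
by rewrite -mulr_sumr sum_ind_supersets mulrCA.
Qed.

(* Pairs of disjoint edges cancel in the second cumulant; what remains are the
   pairs of equal edges and the pairs forming a path on three vertices. *)
Lemma joint_cumulant x y u v : adj x y -> adj u v ->
  joint ([set x; y] :|: [set u; v]) - f x * f y * (f u * f v) =
  (x == u)%:R * ((y == v)%:R * (f x * f y - (f x * f y) ^+ 2)) +
  (x == v)%:R * ((y == u)%:R * (f x * f y - (f x * f y) ^+ 2)) +
  (x == u)%:R * ((y != v)%:R * (f y * (f x - f x ^+ 2) * f v)) +
  (x == v)%:R * ((y != u)%:R * (f y * (f x - f x ^+ 2) * f u)) +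
  (y == u)%:R * ((x != v)%:R * (f x * (f y - f y ^+ 2) * f v)) +
  (y == v)%:R * ((x != u)%:R * (f x * (f y - f y ^+ 2) * f u)).
Proof.
move=> /adj_neq xy /adj_neq uv.
have j3 z t s : z != t -> z != s -> t != s -> joint [set z; t; s] = f z * f t * f s.
  move=> zt zs ts; rewrite /joint -setUA big_setU1 ?inE ?negb_or ?zt //=.
  by have := joint2 ts; rewrite /joint => ->; exact: mulrA.
have [xu|xu] /= := eqVneq x u.
  rewrite -xu in uv *; have [yv|yv] := eqVneq y v.
    rewrite -yv setUid joint2 // (negPf xy) eq_sym ?(negPf xy) ?eqxx /= ?mulr0n ?mulr1n; ring.
  have -> : [set x; y] :|: [set x; v] = [set x; y; v].
    by apply/setP => z; rewrite !inE; do !case: (_ == _).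
  rewrite j3 // (negPf uv) [y == x]eq_sym (negPf xy) /= ?mulr0n ?mulr1n; ring.
have [yu|yu] /= := eqVneq y u.
  rewrite -yu in uv xu *; have [xv|xv] := eqVneq x v.
    rewrite -xv [[set y; x]]setUC setUid joint2 // [y == x]eq_sym (negPf xy) /= ?mulr0n ?mulr1n;
      ring.
  have -> : [set x; y] :|: [set y; v] = [set x; y; v].
    by apply/setP => z; rewrite !inE; do !case: (_ == _).
  rewrite j3 // (negPf uv) /= ?mulr0n ?mulr1n; ring.
have [xv|xv] /= := eqVneq x v.
  rewrite -xv in uv *.
  have -> : [set x; y] :|: [set u; x] = [set x; y; u].
    by apply/setP => z; rewrite !inE; do !case: (_ == _).
  rewrite j3 // [y == x]eq_sym (negPf xy) /= ?mulr0n ?mulr1n; ring.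
have [yv|yv] /= := eqVneq y v.
  rewrite -yv in uv *.
  have -> : [set x; y] :|: [set u; y] = [set x; y; u].
    by apply/setP => z; rewrite !inE; do !case: (_ == _).
  rewrite j3 // ?mulr0n ?mulr1n; ring.
(* Disjoint edges are independent, so nothing remains. *)
have -> : joint ([set x; y] :|: [set u; v]) = f x * f y * (f u * f v).
  have dis : [disjoint [set x; y] & [set u; v]].
    rewrite -setI_eq0; apply/eqP/setP => z; rewrite !inE.
    have [->|_] := eqVneq z x; first by rewrite (negPf xu) (negPf xv).
    by have [->|_] := eqVneq z y; rewrite ?(negPf yu) ?(negPf yv).
  rewrite -(joint2 uv) -(joint2 xy) /joint -bigU //.
  by apply: eq_bigl => z; rewrite !inE.
by rewrite subrr ?mulr0n; ring.
Qed.

(** Of the six terms of [joint_cumulant], the two matchings of equal edges each sum to the edge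
    term, and the four ways of sharing one vertex each sum to the path term. *)
Lemma second_cumulant :
  \sum_x \sum_y \sum_u \sum_v
     ((adj x y)%:R * (adj u v)%:R) * joint ([set x; y] :|: [set u; v])
  - (\sum_x \sum_y (adj x y)%:R * (f x * f y)) ^+ 2 =
  (\sum_x \sum_y (adj x y)%:R * (f x * f y)
   - \sum_x \sum_y (adj x y)%:R * (f x * f y) ^+ 2) *+ 2 +
  (\sum_x \sum_y \sum_z ([&& adj x y, adj y z & x != z])%:R *
      (f x * (f y - f y ^+ 2) * f z)) *+ 4.
Proof.
set E := \sum_x \sum_y _ * (_ * _); set E2 := \sum_x \sum_y _ * _ ^+ 2.
set S3 := \sum_x \sum_y \sum_z _%:R * _.
have -> : E ^+ 2 = \sum_x \sum_y \sum_u \sum_v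
    ((adj x y)%:R * (adj u v)%:R) * (f x * f y * (f u * f v)).
  rewrite expr2 mulr_suml; apply: eq_bigr => x _.
  rewrite mulr_suml; apply: eq_bigr => y _; rewrite mulr_sumr; apply: eq_bigr => u _.
  by rewrite mulr_sumr; apply: eq_bigr => v _; rewrite mulrACA.
pose X x y := f x * f y - (f x * f y) ^+ 2.
pose Y x y z := f x * (f y - f y ^+ 2) * f z.
pose ind (x y u v : T) : K := (adj x y)%:R * (adj u v)%:R.
transitivity (\sum_x \sum_y \sum_u \sum_v ind x y u v *
 ((x == u)%:R * ((y == v)%:R * X x y) + (x == v)%:R * ((y == u)%:R * X x y) +
  (x == u)%:R * ((y != v)%:R * Y y x v) + (x == v)%:R * ((y != u)%:R * Y y x u) +
  (y == u)%:R * ((x != v)%:R * Y x y v) + (y == v)%:R * ((x != u)%:R * Y x y u))).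
  rewrite -sumrB; apply: eq_bigr => x _; rewrite -sumrB; apply: eq_bigr => y _.
  rewrite -sumrB; apply: eq_bigr => u _; rewrite -sumrB; apply: eq_bigr => v _.
  rewrite -mulrBr /ind; case: (boolP (adj x y)) => [xy|_]; last by rewrite !mul0r.
  case: (boolP (adj u v)) => [uv|_]; last by rewrite mulr0 !mul0r.
  by rewrite joint_cumulant.
have split6 (G1 G2 G3 G4 G5 G6 : T -> T -> T -> T -> K) :
  \sum_x \sum_y \sum_u \sum_v ind x y u v *
    (G1 x y u v + G2 x y u v + G3 x y u v + G4 x y u v + G5 x y u v + G6 x y u v) =
  \sum_x \sum_y \sum_u \sum_v ind x y u v * G1 x y u v +
  \sum_x \sum_y \sum_u \sum_v ind x y u v * G2 x y u v +
  \sum_x \sum_y \sum_u \sum_v ind x y u v * G3 x y u v +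
  \sum_x \sum_y \sum_u \sum_v ind x y u v * G4 x y u v +
  \sum_x \sum_y \sum_u \sum_v ind x y u v * G5 x y u v +
  \sum_x \sum_y \sum_u \sum_v ind x y u v * G6 x y u v.
  rewrite -!big_split; apply: eq_bigr => x _; rewrite -!big_split; apply: eq_bigr => y _.
  rewrite -!big_split; apply: eq_bigr => u _; rewrite -!big_split; apply: eq_bigr => v _.
  by rewrite !mulrDr.
rewrite split6.
have aa x y : (adj x y)%:R * (adj x y)%:R = (adj x y)%:R :> K by rewrite -natrM mulnb andbb.
have uD (i : T) (c : T -> K) (G : T -> K) : \sum_u c u * ((i == u)%:R * G u) = c i * G i.
  by rewrite -(sum_delta i (fun u => c u * G u)); apply: eq_bigr => u _; rewrite mulrCA.
have EX : \sum_x \sum_y (adj x y)%:R * X x y = E - E2.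
  rewrite -sumrB; apply: eq_bigr => x _; rewrite -sumrB; apply: eq_bigr => y _.
  by rewrite -mulrBr.
have S3E : S3 = \sum_x \sum_y \sum_z (adj x y)%:R * (adj y z)%:R * ((x != z)%:R * Y x y z).
  apply: eq_bigr => x _; apply: eq_bigr => y _; apply: eq_bigr => z _.
  by rewrite [RHS]mulrA -!natrM !mulnb andbA.
have T1 : \sum_x \sum_y \sum_u \sum_v ind x y u v * ((x == u)%:R * ((y == v)%:R * X x y)) = E - E2.
  rewrite -EX; apply: eq_bigr => x _; apply: eq_bigr => y _.
  rewrite exchange_big /=; under eq_bigr => v _ do rewrite uD.
  by rewrite uD /ind aa.
have T2 : \sum_x \sum_y \sum_u \sum_v ind x y u v * ((x == v)%:R * ((y == u)%:R * X x y)) = E - E2.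
  rewrite -EX; apply: eq_bigr => x _; apply: eq_bigr => y _.
  under eq_bigr => u _ do rewrite uD.
  by rewrite uD /ind [adj y x]adj_sym aa.
have T3 : \sum_x \sum_y \sum_u \sum_v ind x y u v * ((x == u)%:R * ((y != v)%:R * Y y x v)) = S3.
  rewrite S3E [RHS]exchange_big; apply: eq_bigr => x _; apply: eq_bigr => y _.
  rewrite exchange_big; apply: eq_bigr => v _ /=; rewrite uD.
  by rewrite /ind [adj x y]adj_sym.
have T4 : \sum_x \sum_y \sum_u \sum_v ind x y u v * ((x == v)%:R * ((y != u)%:R * Y y x u)) = S3.
  rewrite S3E [RHS]exchange_big; apply: eq_bigr => x _; apply: eq_bigr => y _.
  apply: eq_bigr => u _ /=; rewrite uD.
  by rewrite /ind [adj x y]adj_sym [adj u x]adj_sym.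
have T5 : \sum_x \sum_y \sum_u \sum_v ind x y u v * ((y == u)%:R * ((x != v)%:R * Y x y v)) = S3.
  rewrite S3E; apply: eq_bigr => x _; apply: eq_bigr => y _.
  by rewrite exchange_big; apply: eq_bigr => v _ /=; rewrite uD.
have T6 : \sum_x \sum_y \sum_u \sum_v ind x y u v * ((y == v)%:R * ((x != u)%:R * Y x y u)) = S3.
  rewrite S3E; apply: eq_bigr => x _; apply: eq_bigr => y _.
  by apply: eq_bigr => u _ /=; rewrite uD /ind [adj u y]adj_sym.
rewrite T1 T2 T3 T4 T5 T6; ring.
Qed.
End WeightedSums.

Local Close Scope ring_scope.

(** * Weighted sums determined by the polynomial *)

Local Open Scope ring_scope.

Section Determined.
Variables (T T' : sgraph).
Hypothesis eqG : gdp T = gdp T'.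

(** The product over [A] only involves [#|A|] and the degree sum of [A]. *)
Lemma gdp_weight_eq (K : comNzRingType) (x y : K) (c : nat -> K) :
  \sum_(A : {set T}) c (e_in A) * \prod_(v in A) (x * y ^+ deg v) =
  \sum_(A : {set T'}) c (e_in A) * \prod_(v in A) (x * y ^+ deg v).
Proof.
have aux (G : sgraph) : \sum_(A : {set G}) c (e_in A) * \prod_(v in A) (x * y ^+ deg v) =
  \sum_(A : {set G}) c (e_in A) * (x ^+ #|A| * y ^+ (\sum_(v in A) deg v)%N).
  apply: eq_bigr => A _; congr (_ * _).
  by rewrite big_split prodr_const prodrXr.
by rewrite !aux; apply: (gdp_degsum_eq (fun n s e => c e * (x ^+ n * y ^+ s)) eqG).
Qed.

(** The case [c = 1]. It makes the normalising factors of both graphs equal, so that they cancel in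
    the moments. *)
Lemma prod_weight_eq (K : comNzRingType) (x y : K) :
  \prod_(v : T) (1 + x * y ^+ deg v) = \prod_(v : T') (1 + x * y ^+ deg v).
Proof.
have aux (G : sgraph) : \prod_(v : G) (1 + x * y ^+ deg v) =
   \sum_(A : {set G}) 1 * \prod_(v in A) (x * y ^+ deg v).
  transitivity (\prod_(v in [set: G]) (1 + x * y ^+ deg v)).
    by apply: eq_bigl => v; rewrite inE.
  rewrite -sum_subsets; apply: eq_big => [A|A _]; rewrite ?subsetT ?mul1r //.
by rewrite !aux; apply: (gdp_weight_eq _ _ (fun=> 1)).
Qed.

Section Field.
Variables (K : fieldType) (x y : K).
Hypothesis nz : forall d, 1 + x * y ^+ d != 0.
Notation f d := (x * y ^+ d / (1 + x * y ^+ d)).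

Lemma prod_weight_neq0 : \prod_(v : T) (1 + x * y ^+ deg v) != 0.
Proof. by apply/prodf_neq0 => v _. Qed.

Lemma edge_weight_eq :
  \sum_(u : T) \sum_(v : T) (adj u v)%:R * (f (deg u) * f (deg v)) =
  \sum_(u : T') \sum_(v : T') (adj u v)%:R * (f (deg u) * f (deg v)).
Proof.
have := gdp_weight_eq x y (fun e => (2 * e)%N%:R).
rewrite (sum_e_in1 (fun v => nz (deg v))) (sum_e_in1 (fun v => nz (deg v))).
by rewrite -prod_weight_eq => /(mulfI prod_weight_neq0).
Qed.

Lemma matching_weight_eq (w : K) :
  \sum_(F : {set {set T}} | F \subset edges T)
     w ^+ #|F| * \prod_(v in cover F) f (deg v) =
  \sum_(F : {set {set T'}} | F \subset edges T')
     w ^+ #|F| * \prod_(v in cover F) f (deg v).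
Proof.
have := gdp_weight_eq x y (fun e => (1 + w) ^+ e).
rewrite (sum_e_in_exp (fun v => nz (deg v))) (sum_e_in_exp (fun v => nz (deg v))).
by rewrite -prod_weight_eq => /(mulfI prod_weight_neq0).
Qed.

(** First and second moments agree, hence so do the second cumulants; removing the edge terms leaves
    4 times the path sum. *)
Lemma path3_weight_eq : 4%:R != 0 :> K ->
  \sum_(u : T) \sum_(v : T) (adj u v)%:R * (f (deg u) * f (deg v)) ^+ 2 =
  \sum_(u : T') \sum_(v : T') (adj u v)%:R * (f (deg u) * f (deg v)) ^+ 2 ->
  \sum_(u : T) \sum_(v : T) \sum_(w : T) ([&& adj u v, adj v w & u != w])%:R *
     (f (deg u) * (f (deg v) - f (deg v) ^+ 2) * f (deg w)) =
  \sum_(u : T') \sum_(v : T') \sum_(w : T') ([&& adj u v, adj v w & u != w])%:R *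
     (f (deg u) * (f (deg v) - f (deg v) ^+ 2) * f (deg w)).
Proof.
move=> nz4 E2.
have := gdp_weight_eq x y (fun e => ((2 * e) ^ 2)%N%:R).
rewrite (sum_e_in2 (fun v => nz (deg v))) (sum_e_in2 (fun v => nz (deg v))).
rewrite -prod_weight_eq => /(mulfI prod_weight_neq0) E.
have c1 := second_cumulant (fun v : T => x * y ^+ deg v).
have c2 := second_cumulant (fun v : T' => x * y ^+ deg v).
move: c1; rewrite E edge_weight_eq E2 c2 => /addrI c34.
by apply: (mulIf nz4); rewrite !mulr_natr.
Qed.
End Field.

End Determined.

(** * Numbers of edges and paths by degree *)

Section Counts.
Local Open Scope nat_scope.
(** Ordered pairs are counted, as embeddings are: an edge with both ends of degree [i] counts twice
    in [edge_count T i i]. *)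
Definition edge_count (T : sgraph) (i j : nat) : nat :=
  \sum_(x : T) \sum_(y : T) [&& adj x y, deg x == i & deg y == j].

Definition path_count (T : sgraph) (i j k : nat) : nat :=
  \sum_(x : T) \sum_(y : T) \sum_(z : T)
    [&& [&& adj x y, adj y z & x != z], deg x == i, deg y == j & deg z == k].

Lemma edge_count_sym (T : sgraph) i j : edge_count T i j = edge_count T j i.
Proof.
rewrite /edge_count exchange_big; apply: eq_bigr => x _; apply: eq_bigr => y _.
by rewrite adj_sym [(deg y == i) && _]andbC.
Qed.

Lemma path_count_sym (T : sgraph) i j k : path_count T i j k = path_count T k j i.
Proof.
rewrite /path_count; under eq_bigr do rewrite exchange_big.
rewrite exchange_big; apply: eq_bigr => x _; rewrite exchange_big /=.
apply: eq_bigr => y _; apply: eq_bigr => z _.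
by rewrite [adj z y]adj_sym [adj y x]adj_sym [z == x]eq_sym; do !case: (_ == _);
  rewrite ?andbT ?andbF // andbC.
Qed.

Lemma deg_gt0 (T : sgraph) (x y : T) : adj x y -> 0 < deg x.
Proof. by move=> xy; apply/card_gt0P; exists y; rewrite inE. Qed.

(** Degree 0 is the mirror image of [b = 2 * a]; this settles the boundary case of the condition
    [b >= 2 * a]. *)
Lemma path_count0 (T : sgraph) i j : path_count T i j 0 = 0.
Proof.
rewrite /path_count; do 3![apply: big1 => ? _]; apply/eqP; rewrite eqb0.
apply/negP => /andP[/and3P[_ yz _] /and3P[_ _]].
by apply/negP; rewrite -lt0n; move: yz; rewrite adj_sym; apply: deg_gt0.
Qed.

Lemma deg_lt (T : sgraph) (x : T) : deg x < #|T|.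
Proof.
rewrite /deg -cardsT; apply: proper_card; apply/properP; split; first exact: subsetT.
by exists x; rewrite ?inE ?adj_irrefl.
Qed.
End Counts.

Section Regroup.
Variables (K : pzRingType) (T : sgraph) (B : nat).
Hypothesis TB : (#|T| <= B)%N.

Lemma sum_deg_delta (x : T) (G : nat -> K) :
  G (deg x) = \sum_(i < B) (deg x == i)%:R * G i.
Proof.
have xB : (deg x < B)%N by apply: leq_trans TB; apply: deg_lt.
rewrite (bigD1 (Ordinal xB)) //= eqxx mul1r big1 ?addr0 // => i.
by rewrite -val_eqE eq_sym /= => /negPf ->; rewrite mul0r.
Qed.

Lemma edge_count_regroup (G : nat -> nat -> K) :
  \sum_(x : T) \sum_(y : T) (adj x y)%:R * G (deg x) (deg y) =
  \sum_(i < B) \sum_(j < B) (edge_count T i j)%:R * G i j.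
Proof.
transitivity (\sum_(x : T) \sum_(y : T) \sum_(i < B) \sum_(j < B)
   ([&& adj x y, deg x == i & deg y == j])%:R * G i j).
  apply: eq_bigr => x _; apply: eq_bigr => y _.
  rewrite (sum_deg_delta x (fun i => G i (deg y))) mulr_sumr; apply: eq_bigr => i _.
  rewrite (sum_deg_delta y (fun j => G i j)) !mulr_sumr; apply: eq_bigr => j _.
  by rewrite !mulrA -!natrM !mulnb andbA.
under eq_bigr do rewrite exchange_big; rewrite exchange_big; apply: eq_bigr => i _.
under eq_bigr do rewrite exchange_big; rewrite exchange_big; apply: eq_bigr => j _.
rewrite natr_sum mulr_suml; apply: eq_bigr => x _.
by rewrite natr_sum mulr_suml; apply: eq_bigr.
Qed.

Lemma path_count_regroup (G : nat -> nat -> nat -> K) :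
  \sum_(x : T) \sum_(y : T) \sum_(z : T)
      ([&& adj x y, adj y z & x != z])%:R * G (deg x) (deg y) (deg z) =
  \sum_(i < B) \sum_(j < B) \sum_(k < B) (path_count T i j k)%:R * G i j k.
Proof.
transitivity (\sum_(x : T) \sum_(y : T) \sum_(z : T) \sum_(i < B) \sum_(j < B) \sum_(k < B)
   ([&& [&& adj x y, adj y z & x != z], deg x == i, deg y == j & deg z == k])%:R * G i j k).
  apply: eq_bigr => x _; apply: eq_bigr => y _; apply: eq_bigr => z _.
  rewrite (sum_deg_delta x (fun i => G i (deg y) (deg z))) mulr_sumr; apply: eq_bigr => i _.
  rewrite (sum_deg_delta y (fun j => G i j (deg z))) !mulr_sumr; apply: eq_bigr => j _.
  rewrite (sum_deg_delta z (fun k => G i j k)) !mulr_sumr; apply: eq_bigr => k _.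
  by rewrite !mulrA -!natrM !mulnb -!andbA.
do 3![under eq_bigr do under eq_bigr do rewrite exchange_big;
      under eq_bigr do rewrite exchange_big; rewrite exchange_big; apply: eq_bigr => ? _].
rewrite natr_sum mulr_suml; apply: eq_bigr => x _.
rewrite natr_sum mulr_suml; apply: eq_bigr => y _.
by rewrite natr_sum mulr_suml; apply: eq_bigr.
Qed.
End Regroup.

Section CountsEq.
Variables (T T' : sgraph).
Hypothesis eqG : gdp T = gdp T'.
(** A common bound on the degrees, so that both graphs give sums over the same indices. *)
Let B := (#|T| + #|T'|)%N.
Let TB : (#|T| <= B)%N := leq_addr _ _.
Let TB' : (#|T'| <= B)%N := leq_addl _ _.

Lemma edge_count_eq i j : edge_count T i j = edge_count T' i j.
Proof.
have small (G : sgraph) : (#|G| <= B)%N -> ~~ ((i < B) && (j < B))%N -> edge_count G i j = 0%N.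
  move=> GB; rewrite negb_and -!leqNgt => Bij; rewrite /edge_count.
  apply: big1 => x _; apply: big1 => y _; apply/eqP; rewrite eqb0;
    apply/negP => /and3P[_ /eqP xi /eqP yj].
  have := deg_lt x; have := deg_lt y; rewrite xi yj; move: GB.
  by case/orP: Bij; lia.
case: (boolP ((i < B) && (j < B))%N) => [/andP[iB jB]|nB]; last by rewrite !small.
apply: (@edge_counts_determined B) => //; [exact: edge_count_sym | exact: edge_count_sym |].
move=> a; have nz d := add1_wt_neq0 a (eps_neq0 _) (@epsX_neq1 rat) d.
rewrite -(edge_count_regroup TB (fun i j => frac_wt _ _ i * frac_wt _ _ j)).
rewrite -(edge_count_regroup TB' (fun i j => frac_wt _ _ i * frac_wt _ _ j)).
exact: (edge_weight_eq eqG nz).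
Qed.

Lemma path_count_eq a : path_count T a a a = path_count T' a a a /\
  forall b, (2 * a <= b)%N -> (a < b)%N -> path_count T a a b = path_count T' a a b.
Proof.
have small (G : sgraph) i j k : (#|G| <= B)%N -> (B <= k)%N -> path_count G i j k = 0%N.
  move=> GB Bk; rewrite /path_count.
  do 3![apply: big1 => ? _]; apply/eqP; rewrite eqb0; apply/negP => /and4P[_ _ _ /eqP zk].
  by move: Bk; rewrite leqNgt -zk (leq_trans (deg_lt _) GB).
case: (ltnP a B) => aB; last first.
  split=> [|b _ ab]; first by rewrite !small.
  by rewrite !small // (leq_trans aB (ltnW ab)).
have [||c|d0 dd] := @path3_counts_determined B (path_count T) (path_count T') _ _ _ a aB.
- exact: path_count_sym.
- exact: path_count_sym.
- have nz d := add1_wt_neq0 c (eps_neq0 _) (@epsX_neq1 rat) d.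
  rewrite -(path_count_regroup TB (fun i j k => frac_wt _ _ i * mid_wt _ _ j * frac_wt _ _ k)).
  rewrite -(path_count_regroup TB' (fun i j k => frac_wt _ _ i * mid_wt _ _ j * frac_wt _ _ k)).
  apply: (path3_weight_eq eqG nz).
    (* 4 is pulled back through the two layers of rational functions to [rat]. *)
    by rewrite -(rmorph_nat (cst _)) -(rmorph_nat (cst _)) !fmorph_eq0 pnatr_eq0.
  (* The sum of squares depends on the edge counts only, which are already known to agree. *)
  rewrite (edge_count_regroup TB (fun i j => (frac_wt _ _ i * frac_wt _ _ j) ^+ 2)).
  rewrite (edge_count_regroup TB' (fun i j => (frac_wt _ _ i * frac_wt _ _ j) ^+ 2)).
  by apply: eq_bigr => i _; apply: eq_bigr => j _; rewrite edge_count_eq.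
split=> // b ab lt_ab; case: (ltnP b B) => bB; last by rewrite !small.
by apply: dd; rewrite ?ab ?bB // !path_count0.
Qed.
End CountsEq.

Local Close Scope ring_scope.

(** * Paths on two and three vertices *)

Lemma sorted_tupleP (T : eqType) (e : rel T) m (t : m.-tuple T) :
  reflect (forall i j : 'I_m, i.+1 == j -> e (tnth t i) (tnth t j)) (sorted e t).
Proof.
case: m t => [|m] t; first by rewrite tuple0; constructor => -[].
have x0 := thead t; apply: (iffP (sortedP x0)) => H.
  by move=> i j /eqP ij; rewrite !(tnth_nth x0) -ij; apply: H; rewrite size_tuple ij.
move=> i; rewrite size_tuple => ilt.
by have := H (Ordinal (ltnW ilt)) (Ordinal ilt); rewrite !(tnth_nth x0); apply.
Qed.

Lemma card_embs_path (D : sgraph) (a : D -> nat) m (f : 'I_m -> D) (T : sgraph) :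
  path_order f ->
  #|embs a T| = #|[set t : m.-tuple T | [&& uniq t, sorted (@adj T) t &
                     [forall i, deg (tnth t i) == a (f i)]]]|.
Proof.
case=> -[g fK gK] fA.
pose h (t : m.-tuple T) : {ffun D -> T} := [ffun d => tnth t (g d)].
have hI : injective h.
  move=> t t' /ffunP E; apply: eq_from_tnth => i; have := E (f i).
  by rewrite !ffunE fK.
rewrite -(card_imset _ hI); apply: eq_card => phi; apply/embsP/imsetP.
  case=> pI pA pD; exists [tuple phi (f i) | i < m]; last first.
    by apply/ffunP => d; rewrite ffunE tnth_mktuple gK.
  rewrite inE; apply/and3P; split.
  - by rewrite map_inj_uniq ?enum_uniq // => i j /pI/(can_inj fK).
  - by apply/sorted_tupleP => i j ij; rewrite !tnth_mktuple; apply: pA; rewrite fA ij.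
  - by apply/forallP => i; rewrite tnth_mktuple pD.
case=> t; rewrite inE => /and3P[/tuple_uniqP tI /sorted_tupleP tS /forallP tD] ->.
split=> [u v|u v|u]; rewrite !ffunE.
- by move/tI/(can_inj gK).
- rewrite -{1}[u]gK -{1}[v]gK fA => /orP[]; first exact: tS.
  by move/tS; rewrite adj_sym.
- by rewrite (eqP (tD _)) gK.
Qed.

Lemma sum_nat_bool (I : finType) (P : pred I) : \sum_i P i = #|P|.
Proof. by rewrite -sum1_card [RHS]big_mkcond; apply: eq_bigr => i _; rewrite unfold_in;
  case: (P i). Qed.

Lemma card_embs_path2 (D : sgraph) (a : D -> nat) (f : 'I_2 -> D) (T : sgraph) :
  path_order f ->
  #|embs a T| = edge_count T (a (f (@Ordinal 2 0 isT))) (a (f (@Ordinal 2 1 isT))).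
Proof.
move=> po; rewrite (card_embs_path _ _ po) /edge_count pair_big /= sum_nat_bool.
rewrite -(card_imset _ (_ : injective (fun p : T * T => [tuple p.1; p.2]))); last first.
  by move=> [x y] [x' y'] /(congr1 val) [-> ->].
apply: eq_card => t; rewrite inE; apply/idP/imsetP.
  case/tupleP: t => x t; case/tupleP: t => y t; rewrite (tuple0 t) /=.
  rewrite andbT => /and3P[xy /andP[axy _] /forallP dd].
  exists (x, y); last exact: val_inj.
  rewrite unfold_in /= axy; have := dd (@Ordinal 2 0 isT); have := dd (@Ordinal 2 1 isT).
  by rewrite !(tnth_nth x) /= => -> ->.
case=> -[x y]; rewrite unfold_in /= => /and3P[xy dx dy] ->.
rewrite /= inE (adj_neq xy) xy /=; apply/forallP => i.
by case: i => [[|[|i]] ilt] //=; rewrite (tnth_nth x) /=;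
   [rewrite (eqP dx) | rewrite (eqP dy)]; apply/eqP; congr (a (f _)); apply: val_inj.
Qed.

Lemma card_embs_path3 (D : sgraph) (a : D -> nat) (f : 'I_3 -> D) (T : sgraph) :
  path_order f ->
  #|embs a T| = path_count T (a (f (@Ordinal 3 0 isT))) (a (f (@Ordinal 3 1 isT)))
                             (a (f (@Ordinal 3 2 isT))).
Proof.
move=> po; rewrite (card_embs_path _ _ po) /path_count pair_big /= pair_big /= sum_nat_bool.
rewrite -(card_imset _ (_ : injective (fun p : T * T * T => [tuple p.1.1; p.1.2; p.2])));
  last first.
  by move=> [[x y] z] [[x' y'] z'] /(congr1 val) [-> -> ->].
apply: eq_card => t; rewrite inE; apply/idP/imsetP.
  case/tupleP: t => x t; case/tupleP: t => y t; case/tupleP: t => z t; rewrite (tuple0 t) /=.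
  rewrite !inE negb_or !andbT => /and3P[/andP[/andP[xy xz] yz] /andP[axy ayz] /forallP dd].
  exists (x, y, z); last exact: val_inj.
  rewrite unfold_in /= axy ayz xz; have := dd (@Ordinal 3 0 isT).
  have := dd (@Ordinal 3 1 isT); have := dd (@Ordinal 3 2 isT).
  by rewrite !(tnth_nth x) /= => -> -> ->.
case=> -[[x y] z]; rewrite unfold_in /= => /andP[/and3P[xy yz xz] /and3P[dx dy dz]] ->.
rewrite /= !inE negb_or (adj_neq xy) (adj_neq yz) xy yz xz /=; apply/forallP => i.
by case: i => [[|[|[|i]]] ilt] //=; rewrite (tnth_nth x) /=;
   [rewrite (eqP dx) | rewrite (eqP dy) | rewrite (eqP dz)];
   apply/eqP; congr (a (f _)); apply: val_inj.
Qed.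

Lemma embs_path2_eq (D : sgraph) (a : D -> nat) (T T' : sgraph) :
  gdp T = gdp T' -> path2 D -> #|embs a T| = #|embs a T'|.
Proof. by move=> eqG [f po]; rewrite !(card_embs_path2 _ _ po) (edge_count_eq eqG). Qed.

Lemma embs_path3_const_eq (D : sgraph) (a : D -> nat) (T T' : sgraph) :
  gdp T = gdp T' -> path3_const a -> #|embs a T| = #|embs a T'|.
Proof.
move=> eqG [[f po] ac]; rewrite !(card_embs_path3 _ _ po).
rewrite (ac (f (@Ordinal 3 1 isT)) (f (@Ordinal 3 0 isT))).
rewrite (ac (f (@Ordinal 3 2 isT)) (f (@Ordinal 3 0 isT))).
exact: (path_count_eq eqG _).1.
Qed.

Lemma embs_path3_aab_eq (D : sgraph) (a : D -> nat) (T T' : sgraph) :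
  gdp T = gdp T' -> (forall u, 0 < a u) -> path3_aab a -> #|embs a T| = #|embs a T'|.
Proof.
move=> eqG a0 [f [po [p [q [fp0 fp1 fq le]]]]]; rewrite !(card_embs_path3 _ _ po).
rewrite fp0 fp1 fq; apply: (path_count_eq eqG _).2 => //.
(* Positivity of the labels turns [2 * p <= q] into [p < q]. *)
by have := a0 (f (@Ordinal 3 0 isT)); rewrite fp0; lia.
Qed.

(** * Paths of vertices of degree two *)

Section PathCounts.
Variable T : sgraph.
Implicit Types (X : {set T}) (x y : T).

Definition nbrs X x : {set T} := [set y in X | adj x y].

Definition paths_in k X : {set k.-tuple T} :=
  [set t : k.-tuple T | [&& uniq t, sorted (@adj T) t & all (mem X) t]].

(** The starting vertex is left out of the tuple, so [k] is the number of edges of the path. *)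
Definition tails_from k X x : {set k.-tuple T} :=
  [set t : k.-tuple T | [&& uniq (x :: t), path (@adj T) x t & all (mem X) (x :: t)]].

Lemma all_memD1 X x (s : seq T) :
  all (mem (X :\ x)) s = (x \notin s) && all (mem X) s.
Proof.
elim: s => //= z s ->; rewrite !inE negb_or [x == z]eq_sym.
by rewrite -!andbA; congr (_ && _); rewrite !andbA; congr (_ && _); rewrite andbC.
Qed.

Lemma card_tails0 X x : x \in X -> #|tails_from 0 X x| = 1.
Proof.
move=> xX; rewrite (_ : tails_from 0 X x = [set [tuple]]) ?cards1 //.
by apply/setP => t; rewrite !inE tuple0 /= xX eqxx.
Qed.

Lemma card_tailsS_none k X x : nbrs X x = set0 -> #|tails_from k.+1 X x| = 0.
Proof.
move=> nb0; apply: eq_card0 => t; case/tupleP: t => y t; rewrite inE /=.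
apply/negP => /and3P[_ /andP[xy _] /and3P[_ yX _]].
by have := in_set0 y; rewrite -nb0 inE xy yX.
Qed.

Lemma card_tailsS_one k X x y : x \in X -> nbrs X x = [set y] ->
  #|tails_from k.+1 X x| = #|tails_from k (X :\ x) y|.
Proof.
move=> xX nb1.
have /andP[yX xy] : (y \in X) && adj x y by have := set11 y; rewrite -nb1 inE.
rewrite -(card_imset _ (_ : injective (fun t : k.-tuple T => [tuple of y :: t]))); last first.
  by move=> t t' /(congr1 val) [] /val_inj.
apply: eq_card => t; apply/idP/imsetP.
  case/tupleP: t => z t; rewrite inE => /and3P[/andP[xzt uzt] /andP[xz pzt] /and3P[_ zX tX]].
  have zy : z = y by apply/set1P; rewrite -nb1 inE; apply/andP.
  exists t; last by rewrite zy.
  rewrite inE -zy all_memD1; apply/and3P; split=> //.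
  by apply/andP; split=> //; apply/andP.
case=> t'; rewrite inE all_memD1 => /and3P[ut pt /andP[xt tX]] ->.
by rewrite inE; apply/and3P; split; apply/andP.
Qed.

(** An interior vertex of the path would have two distinct neighbours in [X]. *)
Lemma end_of_path (s : seq T) X x : uniq s -> sorted (@adj T) s -> all (mem X) s ->
  #|nbrs X x| <= 1 -> x \in s -> (ohead s == Some x) || (ohead (rev s) == Some x).
Proof.
move=> us ss sX nb1 xs; case/splitPr: xs us ss sX => l r.
case/lastP: l => [|l z]; first by rewrite /= eqxx.
case: r => [|w r]; first by rewrite rev_cat /= eqxx orbT.
rewrite cat_rcons => us ss sX; exfalso; move: nb1; apply/negP; rewrite -ltnNge.
have /= /and3P[zx xw _] := (cat_sorted2 ss).2.
move: us sX; rewrite cat_uniq all_cat => /and3P[_ _ /= /andP[zin _]] /andP[_ /= /and4P[zX _ wX _]].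
have zw : z != w by apply: contraNneq zin => ->; rewrite !inE eqxx orbT.
apply/card_gt1P; exists z, w; rewrite !inE; split=> //.
  by rewrite [z \in X]zX adj_sym.
by rewrite [w \in X]wX.
Qed.

(** A path through [x] has it first or last, and reversal exchanges these cases. They are disjoint
    because there are at least two vertices. *)
Lemma card_paths_in_rec k X x : x \in X -> #|nbrs X x| <= 1 ->
  #|paths_in k.+2 X| = #|paths_in k.+2 (X :\ x)| + 2 * #|tails_from k.+1 X x|.
Proof.
move=> xX nb1.
pose h (t : k.+1.-tuple T) : k.+2.-tuple T := [tuple of x :: t].
pose h' (t : k.+1.-tuple T) : k.+2.-tuple T := [tuple of rev (h t)].
have hI : injective h by move=> t t' /(congr1 val) [] /val_inj.
have hI' : injective h'.
  by move=> t t' /(congr1 val) /= /(can_inj revK) [] /val_inj.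
have revS (s : seq T) : sorted (@adj T) (rev s) = sorted (@adj T) s.
  by rewrite rev_sorted; apply: eq_sorted => u v; rewrite adj_sym.
have -> : paths_in k.+2 X = paths_in k.+2 (X :\ x) :|:
    (h @: tails_from k.+1 X x :|: h' @: tails_from k.+1 X x).
  apply/setP => t; rewrite !inE all_memD1; apply/idP/idP.
    case/and3P=> ut st tX; rewrite ut st tX andbT /=.
    case: (boolP (x \in t)) => //= xt.
    have /orP[] := end_of_path ut st tX nb1 xt.
      case/tupleP: t ut st tX xt => y t ut st tX xt /eqP[yx]; apply/orP; left.
      rewrite yx in ut st tX *.
      by apply/imsetP; exists t => //; rewrite inE; apply/and3P.
    move=> E; apply/orP; right.
    have [t' tE] : exists t' : k.+2.-tuple T, t = [tuple of rev t'].
      by exists [tuple of rev t]; apply: val_inj; rewrite /= revK.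
    move: E ut st tX {xt}; rewrite tE /= revK rev_uniq revS all_rev => {tE}.
    case/tupleP: t' => y t' /= /eqP[->] ut st tX.
    apply/imsetP; exists t'; last exact: val_inj.
    by rewrite inE; apply/and3P.
  case/or3P=> [/and3P[-> -> /andP[]] //| | ] /imsetP[t']; rewrite inE => /and3P[ut pt tX] ->.
    exact/and3P.
  by rewrite /= rev_uniq revS all_rev; apply/and3P.
rewrite cardsU cardsU !card_imset //.
have -> : h @: tails_from k.+1 X x :&: h' @: tails_from k.+1 X x = set0.
  apply/setP => t; rewrite !inE; apply/negP => /andP[/imsetP[t1 t1P ->] /imsetP[t2 _]].
  move/(congr1 val) => /= E.
  (* A path in both families would start and end at [x], hence repeat it. *)
  have xt1 : x \in tval t1.
    case/tupleP: t2 E => y t2 /=; rewrite !rev_cons -!cats1 -catA /=.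
    case: (rev t2) => [|z r] /= [_ ->]; first by rewrite inE eqxx.
    by rewrite mem_cat !inE eqxx !orbT.
  by move: t1P; rewrite inE /= xt1.
have -> : paths_in k.+2 (X :\ x) :&:
    (h @: tails_from k.+1 X x :|: h' @: tails_from k.+1 X x) = set0.
  apply/setP => t; rewrite !inE all_memD1; apply/negP => /andP[/and3P[_ _ /andP[/negP xt _]]].
  case/orP=> /imsetP[t' _ tE]; apply: xt; rewrite tE ?mem_rev; exact: mem_head.
by rewrite !cards0 !subn0 mul2n addnn.
Qed.

(** Otherwise a path in [X] could be prolonged for ever, acyclicity keeping each new vertex off the
    path. *)
Lemma exists_end X : acyclic T -> X != set0 -> exists2 x, x \in X & #|nbrs X x| <= 1.
Proof.
move=> /acyclicP acT /set0Pn[x0 x0X].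
case: (boolP [exists x in X, #|nbrs X x| <= 1]) => [/exists_inP[x xX nb]|]; first by exists x.
rewrite negb_exists_in => /forall_inP many; exfalso.
have long n : exists s : seq T, [/\ size s = n.+1, uniq s, sorted (@adj T) s & all (mem X) s].
  elim: n => [|n [[|z q] [sz uq sq qX]]] //; first by exists [:: x0]; rewrite /= x0X.
  have zX : z \in X by case/andP: qX.
  have := many z zX; rewrite -ltnNge => /card_gt1P[w1 [w2 [w1n w2n w12]]].
  (* A neighbour other than the next vertex of the path. For empty [q] the default [z] excludes
     nothing, as [z] is not its own neighbour. *)
  have [w wn wq] : exists2 w, w \in nbrs X z & w != head z q.
    have [E|] := eqVneq w1 (head z q); last by exists w1.
    by exists w2; rewrite // -E eq_sym.
  move: wn; rewrite inE => /andP[wX zw].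
  exists (w :: z :: q); split=> //=; [by rewrite -sz | | by rewrite adj_sym zw | ].
    apply/andP; split=> //; rewrite inE negb_or eq_sym adj_neq //=.
    apply/negP => wq'; case/splitPr: wq' uq sq wq {sz qX} => q1 q2 uq sq wq.
    (* If [w] were on the path, the segment from [z] to [w] would close up to a cycle; length at
       most 2 would make [w] the excluded neighbour. *)
    have uc : ucycle (@adj T) (z :: rcons q1 w).
      move: uq sq; rewrite -cat_rcons /= mem_cat cat_uniq negb_or cat_path.
      case/andP=> /andP[zq _] /andP[uq _] /andP[pq _].
      by rewrite /ucycle /= zq uq rcons_path pq last_rcons adj_sym zw.
    have := acT _ uc; rewrite /= size_rcons !ltnS leqn0 size_eq0 => /eqP q1E.
    by rewrite q1E eqxx in wq.
  by rewrite [w \in X]wX [z \in X]zX; case/andP: qX.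
have [s [sz us _ _]] := long #|T|.
by have := max_card (mem s); rewrite (card_uniqP us) sz ltnn.
Qed.
End PathCounts.

(** * Matching polynomials of induced subgraphs *)

Section Matchings.
Local Open Scope ring_scope.
Variables (R : comNzRingType) (T : sgraph) (u : R).
Implicit Types (X : {set T}) (x y : T).

Definition is_matching X (M : {set {set T}}) : bool :=
  [&& M \subset edges T, trivIset M & cover M \subset X].

Definition matching_sum X : R := \sum_(M | is_matching X M) u ^+ #|M|.

Lemma matching_cover X M x : is_matching X M -> x \in cover M ->
  exists2 y, y \in nbrs X x & [set x; y] \in M.
Proof.
case/and3P=> /subsetP ME _ /subsetP MX /bigcupP[e eM xe].
have /edgesP[v [w [vw eE]]] := ME e eM.
have eX z : z \in e -> z \in X by move=> ze; apply: MX; apply/bigcupP; exists e.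
move: xe; rewrite eE !inE => /orP[]/eqP->.
  by exists w; rewrite ?inE ?vw ?eX -?eE // eE set22.
by exists v; rewrite ?inE 1?adj_sym ?vw ?eX ?[[set w; v]]setUC -?eE // eE set21.
Qed.

Lemma is_matchingD1 X M x :
  is_matching (X :\ x) M = is_matching X M && (x \notin cover M).
Proof.
rewrite /is_matching subsetD1 -!andbA; congr (_ && _).
Qed.

Lemma matching_sum0 : matching_sum set0 = 1.
Proof.
rewrite /matching_sum (bigD1 set0) /=; last first.
  by rewrite /is_matching sub0set /trivIset /cover !big_set0 cards0 sub0set eqxx.
rewrite cards0 expr0 big1 ?addr0 // => M /andP[mM /set0Pn[e eM]].
have /and3P[/subsetP ME _ M0] := mM.
have /edgesP[x [y [xy eE]]] := ME e eM.
have : x \in cover M by apply/bigcupP; exists e => //; rewrite eE set21.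
by move: M0; rewrite subset0 => /eqP ->; rewrite inE.
Qed.

Lemma matching_sum_none X x : nbrs X x = set0 -> matching_sum X = matching_sum (X :\ x).
Proof.
move=> nb0; apply: eq_bigl => M; rewrite is_matchingD1.
case: (boolP (is_matching X M)) => //= mM; symmetry; apply/negP => xM.
by have [y] := matching_cover mM xM; rewrite nb0 inE.
Qed.

(** A matching avoids [x] or contains the only edge available at [x]; in the latter case its other
    edges avoid both ends. *)
Lemma matching_sum_one X x y : x \in X -> nbrs X x = [set y] ->
  matching_sum X = matching_sum (X :\ x) + u * matching_sum (X :\ x :\ y).
Proof.
move=> xX nb1; set e0 := [set x; y].
have /andP[yX xy] : (y \in X) && adj x y by have := set11 y; rewrite -nb1 inE.
have e0E : e0 \in edges T by rewrite mem_edges ?adj_neq.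
rewrite /matching_sum (bigID (fun M : {set {set T}} => e0 \notin M)) /=; congr (_ + _).
  apply: eq_bigl => M; rewrite is_matchingD1.
  case: (boolP (is_matching X M)) => //= mM; apply/idP/idP.
    by apply: contraNN => /(matching_cover mM)[z]; rewrite nb1 inE => /eqP ->.
  by apply: contraNN => e0M; apply/bigcupP; exists e0; rewrite ?set21.
rewrite (reindex_onto (fun M => e0 |: M) (fun M => M :\ e0)) /=; last first.
  by move=> M /andP[_]; rewrite negbK => e0M; rewrite setD1K.
rewrite mulr_sumr; apply: eq_big => [M|M]; rewrite !inE eqxx /= andbT.
  rewrite !is_matchingD1; apply/idP/idP.
    case/andP=> /and3P[ME tM MX] /eqP E.
    have e0M : e0 \notin M by rewrite -E !inE eqxx.
    have sM : M \subset e0 |: M by apply: subsetUr.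
    have off z : z \in e0 -> z \notin cover M.
      move=> ze0; apply/negP => /bigcupP[e eM ze].
      have /trivIsetP/(_ e0 e) := tM; rewrite !inE eqxx eM orbT => /(_ isT isT).
      case: (eqVneq e0 e) => [ee|_ /(_ isT)]; first by rewrite -ee (negPf e0M) in eM.
      by rewrite -setI_eq0 => /eqP/setP/(_ z); rewrite in_setI ze0 ze in_set0.
    rewrite !off ?set21 ?set22 // !andbT; apply/and3P; split.
    - exact: subset_trans sM ME.
    - exact: trivIsetS sM tM.
    - by apply: subset_trans MX; apply/bigcupsP => e eM; apply: bigcup_sup; rewrite !inE eM orbT.
  case/andP=> /andP[/and3P[ME tM MX] xM] yM.
  have e0M : e0 \notin M by apply: contraNN xM => e0M; apply/bigcupP; exists e0; rewrite ?set21.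
  rewrite setU1K // eqxx andbT; apply/and3P; split.
  - by rewrite subUset sub1set e0E.
  - have [|||//] := @trivIsetU1 _ e0 M.
    + move=> e eM; rewrite -setI_eq0; apply/eqP/setP => z; rewrite !inE.
      apply/negP => /andP[/orP[]/eqP-> ze].
        by case/negP: xM; apply/bigcupP; exists e.
      by case/negP: yM; apply/bigcupP; exists e.
    + exact: tM.
    + apply/negP => M0; have := edge_card (subsetP ME _ M0).
      by rewrite cards0.
  - apply/bigcupsP => e; rewrite !inE => /orP[/eqP->|eM].
      by rewrite subUset !sub1set xX yX.
    by apply: subset_trans MX; apply: bigcup_sup.
case/andP=> _ /eqP E; have e0M : e0 \notin M by rewrite -E !inE eqxx.
by rewrite cardsU1 e0M exprS.
Qed.
End Matchings.

(** * Matchings and paths in linear forests *)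

Section LinearForest.
Local Open Scope ring_scope.
Variables (F : fieldType) (s : F) (T : sgraph).
Hypothesis s1_neq0 : 1 + s != 0.
Hypothesis acT : acyclic T.
Implicit Types (X : {set T}) (x y : T).

(* With this activity, the matching polynomial of a path on [m] vertices
   becomes the [q]-integer [m + 1] at [q = s]. *)
Definition activity : F := - s / (1 + s) ^+ 2.

(** The power of [1 + s] clears the denominators of [activity], and the leaf recursion becomes that
    of the q-integers, with coefficients [1 + s] and [- s]. *)
Definition scaled_matching X : F := (1 + s) ^+ #|X| * matching_sum activity X.

Lemma scaled_matching0 : scaled_matching set0 = 1.
Proof. by rewrite /scaled_matching cards0 matching_sum0 mulr1. Qed.

Lemma scaled_matching_none X x : x \in X -> nbrs X x = set0 ->
  scaled_matching X = (1 + s) * scaled_matching (X :\ x).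
Proof.
move=> xX nb0; rewrite /scaled_matching (cardsD1 x X) xX add1n exprS -mulrA.
by rewrite (matching_sum_none _ nb0).
Qed.

Lemma scaled_matching_one X x y : x \in X -> nbrs X x = [set y] ->
  scaled_matching X = (1 + s) * scaled_matching (X :\ x) - s * scaled_matching (X :\ x :\ y).
Proof.
move=> xX nb1; rewrite /scaled_matching (matching_sum_one _ xX nb1).
have yX : y \in X :\ x.
  by have := set11 y; rewrite -nb1 !inE => /andP[-> /adj_neq]; rewrite eq_sym => ->.
rewrite (cardsD1 x X) xX (cardsD1 y (X :\ x)) yX !add1n !exprS /activity.
by field.
Qed.

Definition q_factor (m : nat) : F := 1 - s ^+ m.

(** [m] is the size of the component of [x] and [ms] lists the other sizes. The values at [X] and
    [X :\ x] are carried together since the recursion has order two; a component that becomes empty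
    still yields [q_factor 1 = 1 - s]. A path on [l] vertices has [l.+1 - k.+2] subpaths on [k.+2]
    vertices, truncated to 0 when too short, each read in two directions. *)
Lemma linear_forest X x : (forall v, v \in X -> #|nbrs X v| <= 2)%N -> x \in X ->
  (#|nbrs X x| <= 1)%N ->
  exists m (ms : seq nat), [/\ all (leq 1) (m :: ms),
    scaled_matching X * (1 - s) ^+ (size ms).+1 =
      q_factor m.+1 * \prod_(k <- ms) q_factor k.+1,
    scaled_matching (X :\ x) * (1 - s) ^+ (size ms).+1 =
      q_factor m * \prod_(k <- ms) q_factor k.+1,
    forall k, #|tails_from k X x| = (k < m)%N :> nat &
    forall k, #|paths_in k.+2 X| = (2 * \sum_(l <- m :: ms) (l.+1 - k.+2))%N].
Proof.
have [n] := ubnP #|X|; elim: n X x => // n IH X x Xn d2 xX nb1.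
have d2D v : v \in X :\ x -> (#|nbrs (X :\ x) v| <= 2)%N.
  rewrite inE => /andP[_ vX]; apply: leq_trans (d2 v vX); apply: subset_leq_card.
  by apply/subsetP => w; rewrite !inE -andbA => /andP[].
have XDn : (#|X :\ x| < n)%N by move: Xn; rewrite (cardsD1 x X) xX.
have [nb0|] := eqVneq (nbrs X x) set0.
  have tails k : #|tails_from k X x| = (k < 1)%N.
    by case: k => [|k]; [rewrite card_tails0 | rewrite card_tailsS_none].
  have paths k : #|paths_in k.+2 X| = #|paths_in k.+2 (X :\ x)|.
    by rewrite (card_paths_in_rec k xX nb1) tails muln0 addn0.
  have Zx := scaled_matching_none xX nb0.
  have q2 : q_factor 2 = (1 + s) * (1 - s) by rewrite /q_factor; ring.
  have q1 : q_factor 1 = 1 - s by [].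
  have [X0|Xn0] := eqVneq (X :\ x) set0.
    exists 1%N, [::]; split=> // [||k].
    - by rewrite Zx X0 scaled_matching0 big_nil q2 expr1; ring.
    - by rewrite X0 scaled_matching0 big_nil q1 expr1; ring.
    rewrite paths X0 big_seq1 !subSS sub0n /= muln0; apply: eq_card0 => t.
    by case/tupleP: t => z t; rewrite !inE /= !inE !andbF.
  (* As [x] is isolated, the induction restarts at an end of another component. *)
  have [x' x'X nb'] := exists_end acT Xn0.
  have [m' [ms' [pos Z1 Z2 H P]]] := IH _ x' XDn d2D x'X nb'.
  exists 1%N, (m' :: ms'); split=> // [||k].
  - by rewrite Zx q2 [X in _ * X]exprS big_cons -Z1 /=; ring.
  - by rewrite q1 [X in _ * X]exprS big_cons -Z1 /=; ring.
  by rewrite paths P [in RHS]big_cons !subSS sub0n add0n.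
rewrite -card_gt0 => nb_gt0.
have /cards1P[y nby] : #|nbrs X x| == 1%N by rewrite eqn_leq nb1.
have /andP[yX xy] : (y \in X) && adj x y by have := set11 y; rewrite -nby inE.
have yXx : y \in X :\ x by rewrite !inE yX eq_sym adj_neq.
have nb' : (#|nbrs (X :\ x) y| <= 1)%N.
  rewrite -ltnS; apply: leq_trans (d2 y yX); apply: proper_card; apply/properP; split.
    by apply/subsetP => w; rewrite !inE -andbA => /andP[].
  by exists x; rewrite !inE ?eqxx // xX adj_sym.
(* Removing [x] shortens its component by one vertex and makes [y] an end. *)
have [m' [ms' [pos Z1 Z2 H P]]] := IH _ y XDn d2D yXx nb'.
exists m'.+1, ms'; split=> // [||k|k].
- by case/andP: pos.
- rewrite (scaled_matching_one xX nby).
  have -> (c1 c2 c3 : F) : ((1 + s) * c1 - s * c2) * c3 = (1 + s) * (c1 * c3) - s * (c2 * c3) by ring.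
  by rewrite Z1 Z2 /q_factor !exprS; ring.
- by case: k => [|k]; rewrite ?card_tails0 // (card_tailsS_one _ xX nby) H.
rewrite (card_paths_in_rec k xX nb1) P (card_tailsS_one _ xX nby) H !big_cons; lia.
Qed.
End LinearForest.

Section AllTwo.
Notation Qs := (ratfun rat).
Notation s := (eps rat).

Definition deg_set (T : sgraph) (d : nat) : {set T} := [set v : T | deg v == d].

(** For a singleton the degree sum is the degree of its vertex. *)
Lemma card_deg_set_eq (T T' : sgraph) d : gdp T = gdp T' ->
  #|deg_set T d| = #|deg_set T' d|.
Proof.
move=> /(gdp_degsum_eq (fun n s _ => (n == 1) && (s == d) : nat)).
have aux (G : sgraph) :
   (\sum_(A : {set G}) ((#|A| == 1) && (\sum_(x in A) deg x == d)))%N = #|deg_set G d|.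
  rewrite sum_nat_bool -(card_imset _ (@set1_inj G)); apply: eq_card => A.
  rewrite unfold_in; apply/andP/imsetP => [[/cards1P[x ->]]|[x]].
    by rewrite big_set1 => dx; exists x; rewrite ?inE.
  by rewrite inE => dx ->; rewrite cards1 big_set1.
by rewrite !aux.
Qed.

(** The factor [eps ^+ 2] per edge exceeds the poles by [2 * #|M| - #|cover M|], which is 0 only for
    disjoint edges. At [eps = 0] each covered vertex of degree 2 gives -1 and any other gives 0; a
    matching covers an even number, so the signs cancel. *)
Lemma reg_matching_weight (T : sgraph) (F : fieldType) (y u : F) :
  (y != 0)%R -> (forall k, 0 < k -> (y ^+ k != 1)%R) ->
  reg (\sum_(M : {set {set T}} | M \subset edges T)
         (cst F u * eps F ^+ 2) ^+ #|M| * \prod_(v in cover M) frac_wt y 2 (deg v))%R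
      (matching_sum u (deg_set T 2)).
Proof.
move=> y0 y1.
have sum_card (M : {set {set T}}) : M \subset edges T -> \sum_(e in M) #|e| = 2 * #|M|.
  move=> /subsetP ME; rewrite mulnC -sum_nat_const; apply: eq_bigr => e /ME.
  exact: edge_card.
have -> : matching_sum u (deg_set T 2) = (\sum_(M : {set {set T}} | M \subset edges T)
   u ^+ #|M| * (0 ^+ (2 * #|M| - #|cover M|)%N * \prod_(v in cover M) - (deg v == 2)%:R))%R.
  rewrite /matching_sum big_mkcondr; apply: eq_bigr => M ME.
  have cov := leq_card_cover M; rewrite (sum_card M ME) in cov.
  case: (boolP (trivIset M)) => [tM|ntM] /=; last first.
    have : #|cover M| < 2 * #|M| by rewrite ltn_neqAle cov.1 cov.2 andbT.
    by rewrite -subn_gt0 expr0n => /gtn_eqF ->; rewrite !(mul0r, mulr0).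
  have -> : #|cover M| = 2 * #|M| by apply/eqP; rewrite cov.2.
  rewrite subnn expr0 mul1r; case: ifP => [/subsetP cX|/negbT/subsetPn[v vM vX]].
    rewrite (eq_bigr (fun=> -1)%R) => [|v /cX]; last by rewrite inE => ->.
    rewrite prodr_const (_ : #|cover M| = 2 * #|M|) ?exprM ?sqrrN ?expr1n ?mulr1 //.
    by apply/eqP; rewrite cov.2.
  by move: vX; rewrite inE => /negPf vX; rewrite (bigD1 v) //= vX oppr0 mul0r mulr0.
apply: reg_sum => M ME.
have le : (#|cover M| <= 2 * #|M|)%N by rewrite -(sum_card M ME) leq_card_cover.
have -> : ((cst F u * eps F ^+ 2) ^+ #|M| * \prod_(v in cover M) frac_wt y 2 (deg v) =
  cst F (u ^+ #|M|) * (eps F ^+ (2 * #|M| - #|cover M|) *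
     \prod_(v in cover M) (eps F * frac_wt y 2 (deg v))))%R.
  rewrite exprMn rmorphXn -!mulrA; congr (_ * _)%R.
  by rewrite [in RHS]big_split /= prodr_const mulrA -exprD subnK // exprM.
apply: (regM (reg_cst _)); apply: regM; first exact/regX/reg_eps.
by apply: reg_prod => v _; apply: reg_eps_frac_wt.
Qed.

Lemma matching_sum_eq (T T' : sgraph) (u : Qs) : gdp T = gdp T' ->
  matching_sum u (deg_set T 2) = matching_sum u (deg_set T' 2).
Proof.
move=> eqG; have nz d := add1_wt_neq0 2 (eps_neq0 _) (@epsX_neq1 rat) d.
have := reg_matching_weight T u (eps_neq0 _) (@epsX_neq1 rat).
have := reg_matching_weight T' u (eps_neq0 _) (@epsX_neq1 rat).
by rewrite -(matching_weight_eq eqG nz) => r' r; apply: reg_uniq r r'.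
Qed.

Lemma add1_eps_neq0 : (1 + s != 0)%R.
Proof.
by apply: reg_neq0 (oner_neq0 _); rewrite -[X in reg _ X]addr0; apply: regD (reg1 _) (reg_eps _).
Qed.

Lemma nbrs_deg (T : sgraph) (X : {set T}) v : #|nbrs X v| <= deg v.
Proof. by apply: subset_leq_card; apply/subsetP => w; rewrite !inE => /andP[]. Qed.

Lemma deg2_forest (T : sgraph) : is_tree T -> exists ms : seq nat,
  [/\ all (leq 1) ms,
    (scaled_matching s (deg_set T 2) * (1 - s) ^+ size ms = \prod_(k <- ms) (1 - s ^+ k.+1))%R &
    forall k, #|paths_in k.+2 (deg_set T 2)| = 2 * \sum_(l <- ms) (l.+1 - k.+2)].
Proof.
case/and3P=> _ _ acT; have [X0|Xn0] := eqVneq (deg_set T 2) set0.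
  exists [::]; split=> // [|k]; first by rewrite X0 scaled_matching0 big_nil mulr1.
  rewrite X0 big_nil muln0; apply: eq_card0 => t.
  by case/tupleP: t => z t; rewrite !inE /= !inE !andbF.
have [x xX nb] := exists_end acT Xn0.
have [|m [ms [pos Z1 _ _ P]]] := linear_forest add1_eps_neq0 acT _ xX nb.
  by move=> v; rewrite inE => /eqP <-; apply: nbrs_deg.
by exists (m :: ms); split=> //; rewrite big_cons.
Qed.

(** The numbers of components are not yet known to agree, so each product is padded with the factors
    [1 - s] of the other side. Component factors have exponents at least 2, hence the exponents 1
    count the padding. *)
Lemma card_paths_in_deg2_eq (T T' : sgraph) k : gdp T = gdp T' ->
  is_tree T -> is_tree T' ->
  #|paths_in k.+2 (deg_set T 2)| = #|paths_in k.+2 (deg_set T' 2)|.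
Proof.
move=> eqG /deg2_forest[L [L1 ZL PL]] /deg2_forest[L' [L1' ZL' PL']].
have Zeq : scaled_matching s (deg_set T 2) = scaled_matching s (deg_set T' 2).
  by rewrite /scaled_matching (card_deg_set_eq _ eqG) (matching_sum_eq _ eqG).
have pos (r : seq nat) n : all (leq 1) (map succn r ++ nseq n 1).
  by rewrite all_cat all_nseq orbT andbT all_map; apply/allP.
have prodE (r : seq nat) n : (\prod_(m <- map succn r ++ nseq n 1%N) (1 - s ^+ m) =
    (\prod_(k <- r) (1 - s ^+ k.+1)) * (1 - s) ^+ n)%R.
  by rewrite big_cat /= big_map big_nseq iter_mulr_1 expr1.
have P : perm_eq (map succn L ++ nseq (size L') 1) (map succn L' ++ nseq (size L) 1).
  apply: euler_product_eps_uniq; rewrite ?pos // !prodE -ZL -ZL' Zeq.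
  exact: mulrAC.
have no1 (r : seq nat) : all (leq 1) r -> count_mem 1 (map succn r) = 0.
  by move=> r1; rewrite count_map; apply/eqP; rewrite -leqn0 leqNgt -has_count;
     apply/hasPn => l /(allP r1); case: l.
have sz : size L = size L'.
  move/permP: (P) => /(_ (pred1 1)); rewrite !count_cat !no1 // !count_nseq /= !mul1n.
  by [].
move: P; rewrite sz perm_cat2r => /(perm_map_inj succn_inj) P.
by rewrite PL PL' (perm_big _ P).
Qed.

Lemma embs_path_all2_eq (D : sgraph) (a : D -> nat) (T T' : sgraph) :
  gdp T = gdp T' -> is_tree D -> is_tree T -> is_tree T' -> path_all2 a ->
  #|embs a T| = #|embs a T'|.
Proof.
move=> eqG /andP[D0 _] treeT treeT' [[m [f po]] a2].
have embE (G : sgraph) : #|embs a G| = #|paths_in m (deg_set G 2)|.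
  rewrite (card_embs_path _ _ po); apply: eq_card => t; rewrite !inE.
  congr [&& _, _ & _]; apply/forallP/all_tnthP => H i; have := H i.
    by rewrite a2 /= inE.
  by rewrite a2 /= inE.
(* [m = 0] is excluded as [D] is non-empty, and [m = 1] counts the vertices of degree 2. *)
rewrite !embE; case: m f po {embE} => [|[|k]] f po; last exact: card_paths_in_deg2_eq.
  case: po => -[g _ _] _; case/card_gt0P: D0 => d _.
  by case: (g d).
have one (G : sgraph) : #|paths_in 1 (deg_set G 2)| = #|deg_set G 2|.
  rewrite -(card_imset _ (_ : injective (fun v : G => [tuple v]))); last first.
    by move=> v w /(congr1 val) [].
  apply: eq_card => t; apply/idP/imsetP.
    case/tupleP: t => v t; rewrite (tuple0 t) inE /= !andbT => vX.
    by exists v => //; apply: val_inj.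
  by case=> v vX ->; rewrite inE /= andbT.
by rewrite !one; apply: card_deg_set_eq.
Qed.
End AllTwo.

(** * Stars *)

Section StarEmbeddings.
Variables (D : sgraph) (a : D -> nat) (c : D) (T : sgraph).
Hypothesis starD : star_center c.
Hypothesis outer1 : forall u, u != c -> a u = 1.

Definition leaf_nbrs (G : sgraph) (v : G) : {set G} := nbrs (deg_set G 1) v.

Lemma star_adjc u : adj c u = (u != c).
Proof. by rewrite starD eqxx /= andbT eq_sym. Qed.

(** Once the centre is sent to [v], an embedding is an injection of the outer vertices into the
    leaves at [v]. *)
Lemma card_embs_star :
  #|embs a T| = \sum_(v in deg_set T (a c)) #|leaf_nbrs v| ^_ #|D|.-1.
Proof.
rewrite -sum1_card (partition_big (fun f : {ffun D -> T} => f c) (mem (deg_set T (a c)))) /=;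
  last first.
  by move=> f /embsP[_ _ fD]; rewrite inE fD.
apply: eq_bigr => v; rewrite inE => /eqP dv.
pose O : finType := {u : D | u != c}.
have cardO : #|O| = #|D|.-1 by rewrite card_sig -(cardC1 c); apply: eq_card => u; rewrite !inE.
rewrite -cardO -card_inj_ffuns_on sum1dep_card.
pose h (f : {ffun D -> T}) : {ffun O -> T} := [ffun u => f (val u)].
rewrite -(card_in_imset (f := h)); last first.
  move=> f f'; rewrite !inE => /andP[_ /eqP fc] /andP[_ /eqP fc'] /ffunP E.
  apply/ffunP => u; have [->|uc] := eqVneq u c; first by rewrite fc fc'.
  by have := E (Sub u uc); rewrite !ffunE.
apply: eq_card => g; rewrite [RHS]inE; apply/imsetP/andP.
  case=> f; rewrite inE => /andP[/embsP[fI fA fD] /eqP fc] ->; split.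
    apply/ffun_onP => u; rewrite ffunE !inE -fc -fD outer1 ?(valP u) //= fA //.
    by rewrite star_adjc (valP u).
  by apply/injectiveP => u w; rewrite !ffunE => /fI/val_inj.
case=> /ffun_onP gR /injectiveP gI.
(* The centre is the vertex outside [O], and the default value sends it to [v]. *)
pose f : {ffun D -> T} := [ffun u => oapp g v (insub u : option O)].
have fc : f c = v by rewrite ffunE insubF //= eqxx.
have fo (u : O) : f (val u) = g u by rewrite ffunE valK.
have foD u (uc : u != c) : f u = g (Sub u uc : O) by rewrite -fo.
have gRv (u : O) : deg (g u) = 1 /\ adj v (g u).
  by have := gR u; rewrite !inE => /andP[/eqP].
have gv (u : O) : g u != v by rewrite eq_sym; apply: adj_neq; case: (gRv u).
exists f; last by apply/ffunP => u; rewrite ffunE fo.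
rewrite inE fc eqxx andbT; apply/embsP; split.
- move=> u w; have [->|uc] := eqVneq u c; have [->|wc] := eqVneq w c => //.
  + by rewrite fc (foD w wc) => E; have := gv (Sub w wc); rewrite -E eqxx.
  + by rewrite fc (foD u uc) => E; have := gv (Sub u uc); rewrite E eqxx.
  + by rewrite (foD u uc) (foD w wc) => /gI [].
- move=> u w; rewrite starD => /andP[uw /orP[]/eqP E].
    by rewrite E eq_sym in uw *; rewrite fc (foD w uw); case: (gRv (Sub w uw)).
  by rewrite E in uw *; rewrite fc (foD u uw) adj_sym; case: (gRv (Sub u uw)).
- move=> u; have [->|uc] := eqVneq u c; first by rewrite fc dv.
  by rewrite outer1 // (foD u uc); case: (gRv (Sub u uc)).
Qed.
End StarEmbeddings.

Section TreeLeaves.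
Variable T : sgraph.
Hypothesis treeT : is_tree T.

Lemma tree_deg_gt0 (x : T) : 1 < #|T| -> 0 < deg x.
Proof.
case/and3P: treeT => _ /forallP con _ /card_gt1P[y [z [_ _ yz]]].
have [w wx] : exists w, w != x.
  by have [yx|] := eqVneq y x; [exists z; rewrite -yx eq_sym | exists y].
have /forallP/(_ w)/connectP[[|v p] /=] := con x; first by move=> _ E; rewrite E eqxx in wx.
by case/andP=> xv _ _; apply: deg_gt0 xv.
Qed.

Lemma leaf_unique_nbr (x y z : T) : deg x = 1 -> adj x y -> adj x z -> y = z.
Proof.
move=> /eqP/cards1P[w E] xy xz.
have : y \in [set w] by rewrite -E inE.
have : z \in [set w] by rewrite -E inE.
by rewrite !inE => /eqP -> /eqP ->.
Qed.

(** Two adjacent leaves would form a whole connected component. *)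
Lemma leaves_not_adj (x y : T) : 2 < #|T| -> deg x = 1 -> adj x y -> deg y != 1.
Proof.
move=> T3 dx xy; apply/eqP => dy.
have stay p : forall z, z \in [set x; y] -> path (@adj T) z p -> last z p \in [set x; y].
  elim: p => //= v p IH z zin /andP[zv]; apply: IH; move: zin zv; rewrite !inE.
  case/orP=> /eqP-> zv; first by rewrite -(leaf_unique_nbr dx xy zv) eqxx orbT.
  by rewrite adj_sym in xy; rewrite -(leaf_unique_nbr dy xy zv) eqxx.
case/and3P: treeT => _ /forallP con _; move: T3; rewrite ltnNge => /negP; apply.
apply: leq_trans (_ : #|[set x; y]| <= 2); last by rewrite cards2; case: (_ != _).
apply: subset_leq_card; apply/subsetP => z _.
by have /forallP/(_ z)/connectP[p pp ->] := con x; apply: stay => //; rewrite set21.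
Qed.

Hypothesis T3 : 2 < #|T|.
Notation L := (deg_set T 1).

Definition leaf_parent (l : T) : T := odflt l [pick y | adj l y].

Lemma leaf_parentP (l v : T) : l \in L -> (leaf_parent l == v) = adj v l.
Proof.
rewrite inE /leaf_parent => /eqP dl; case: pickP => [w lw|none] /=.
  apply/eqP/idP => [<-|]; rewrite adj_sym // => lv; exact: leaf_unique_nbr dl lw lv.
by move: dl; rewrite /deg eq_card0 // => y; rewrite inE none.
Qed.

Lemma adj_leaf_parent l : l \in L -> adj l (leaf_parent l).
Proof. by move=> lL; rewrite adj_sym -leaf_parentP. Qed.

(** Since no edge joins two leaves, an edge not inside [B] joins a leaf in [C] to its parent in
    [B]. *)
Lemma e_in_leaves (B C : {set T}) : B \subset ~: L -> C \subset L ->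
  e_in (B :|: C) = e_in B + #|[set l in C | leaf_parent l \in B]|.
Proof.
move=> /subsetP BI /subsetP CL.
have BL v : v \in B -> v \notin L by move/BI; rewrite inE.
pose h l := [set l; leaf_parent l].
have hI : {in [set l in C | leaf_parent l \in B] &, injective h}.
  move=> l l'; rewrite !inE => /andP[lC lB] /andP[lC' lB'] /set2_inj[][// E _].
  by have := BL _ lB'; rewrite -E (CL _ lC).
rewrite -(card_in_imset hI) /e_in -cardsUI.
have -> : [set e in edges T | e \subset B] :&: h @: [set l in C | leaf_parent l \in B] = set0.
  apply/setP => e; rewrite !inE; apply/negP => /andP[/andP[_ /subsetP eB]] /imsetP[l].
  rewrite inE => /andP[lC _] eE; have := BL l; rewrite eB ?(CL _ lC) ?eE ?set21 //.
  by move=> /(_ isT).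
rewrite cards0 addn0; apply: eq_card => e; rewrite !inE; apply/andP/orP.
  case=> eE eBC; have [x [y [xy eE']]] := edgesP _ eE.
  move: eBC; rewrite eE' subUset !sub1set !inE => /andP[/orP[xB|xC] /orP[yB|yC]].
  - by left; rewrite -eE' eE eE' subUset !sub1set xB yB.
  - right; apply/imsetP; exists y;
    last by rewrite /h setUC (eqP (_ : leaf_parent y == x)) // leaf_parentP ?CL.
    by rewrite inE yC (eqP (_ : leaf_parent y == x)) // leaf_parentP ?CL.
  - right; apply/imsetP; exists x;
    last by rewrite /h (eqP (_ : leaf_parent x == y)) // leaf_parentP ?CL // adj_sym.
    by rewrite inE xC (eqP (_ : leaf_parent x == y)) // leaf_parentP ?CL // adj_sym.
  - have := CL _ xC; have := CL _ yC; rewrite !inE => dy /eqP dx.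
    by have := leaves_not_adj T3 dx xy; rewrite dy.
case=> [/andP[eE eB]|/imsetP[l]]; first by split=> //; apply: subset_trans eB (subsetUl _ _).
rewrite inE => /andP[lC lB] ->; split.
  by rewrite mem_edges ?adj_neq ?adj_leaf_parent ?CL.
by rewrite subUset !sub1set !inE lC lB orbT.
Qed.

Lemma card_leaf_parent_in (B : {set T}) :
  #|[set l in L | leaf_parent l \in B]| = \sum_(v in B) #|leaf_nbrs v|.
Proof.
rewrite -sum1_card (partition_big leaf_parent (mem B)) /=; last first.
  by move=> l; rewrite inE => /andP[].
apply: eq_bigr => v vB; rewrite sum1dep_card; apply: eq_card => l.
rewrite !inE -andbA; case: (boolP (deg l == 1)) => //= dl.
have lL : l \in L by rewrite inE.
rewrite -leaf_parentP //; case: eqP => [->|]; by rewrite ?vB ?andbF.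
Qed.

(** Split [A] into its inner part [B] and its leaves, and sum over the leaves first: a leaf
    contributes [1 + q * z] if its parent is in [B] and [1 + q] otherwise, so [b] factors out once
    per leaf. *)
Lemma leaf_expansion (R : comNzRingType) (p : T -> R) (q z b t : R) :
  (forall l, l \in L -> p l = q) -> (1 + q = b)%R -> (1 + q * z = b * t)%R ->
  (\sum_(A : {set T}) z ^+ e_in A * \prod_(v in A) p v =
   b ^+ #|L| * \sum_(B : {set T} | B \subset ~: L)
     z ^+ e_in B * \prod_(v in B) (p v * t ^+ #|leaf_nbrs v|))%R.
Proof.
move=> pq qb qz.
rewrite (partition_big (fun A => A :&: ~: L) (fun B => B \subset ~: L)) /=; last first.
  by move=> A _; apply: subsetIr.
rewrite mulr_sumr; apply: eq_bigr => B BI.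
rewrite (reindex_onto (fun C => B :|: C) (fun A => A :&: L)) /=; last first.
  by move=> A /eqP <-; rewrite -setIUr setUC setUCr setIT.
rewrite (eq_bigl (fun C : {set T} => C \subset L)) /=; last first.
  move=> C; apply/andP/idP => [[_ /eqP <-]|CL]; first exact: subsetIr.
  rewrite !setIUl (setIidPl BI) (setIidPl CL).
  have -> : C :&: ~: L = set0 by apply/eqP; rewrite setI_eq0 disjoints_subset setCK.
  have -> : B :&: L = set0 by apply/eqP; rewrite setI_eq0 disjoints_subset.
  by rewrite setU0 set0U !eqxx.
transitivity (\sum_(C : {set T} | C \subset L) (z ^+ e_in B * \prod_(v in B) p v) *
   \prod_(l in C) (q * z ^+ (leaf_parent l \in B)))%R.
  apply: eq_bigr => C CL; rewrite e_in_leaves // exprD.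
  have dis : [disjoint B & C].
    by rewrite disjoints_subset; apply: subset_trans BI _; rewrite setCS.
  rewrite (eq_bigl (mem [predU B & C])) => [|v]; last by rewrite !inE.
  rewrite bigU //= big_split /= mulrACA; congr (_ * _)%R.
  rewrite mulrC; congr (_ * _)%R; first by apply: eq_bigr => l /(subsetP CL)/pq.
  by rewrite prodrXr -sum1dep_card big_mkcondr.
rewrite -mulr_sumr sum_subsets.
have -> : (\prod_(l in L) (1 + q * z ^+ (leaf_parent l \in B)) =
   b ^+ #|L| * \prod_(v in B) t ^+ #|leaf_nbrs v|)%R.
  rewrite prodrXr -card_leaf_parent_in -prodr_const -sum1dep_card big_mkcondr -prodrXr -big_split.
  apply: eq_bigr => l _ /=; case: (_ \in B); rewrite ?expr1 ?qz //.
  by rewrite expr0 !mulr1 qb.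
by rewrite [in RHS]big_split /= mulrCA -mulrA.
Qed.
End TreeLeaves.

Lemma wt0_exp (F : fieldType) (t : F) n d : (t != 0)%R -> 0 < d ->
  wt0 (t ^+ n)%R 1 d = (- t ^+ (n * d.-1)%N)%R.
Proof.
move=> t0 d0; rewrite /wt0 expr1 -{1}(prednK d0) exprS mulrC mulKf ?expf_neq0 //.
by rewrite -exprM.
Qed.

Section StarEq.
Notation Qs := (ratfun rat).
Notation s := (eps rat).
Local Open Scope ring_scope.

(** Two digits in base [#|T|]: the leaf number is smaller than the base, so both entries can be read
    off. *)
Definition inner_code (T : sgraph) (v : T) : nat := (#|T| * (deg v).-1 + #|leaf_nbrs v|)%N.

Lemma gdp_card_eq (T T' : sgraph) : gdp T = gdp T' -> #|T| = #|T'|.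
Proof.
have aux (G : sgraph) : (\sum_(A : {set G}) 1 = 2 ^ #|G|)%N.
  by rewrite sum1_card -(cardsT G) -card_powerset powersetT cardsT.
move=> /(gdp_sum_eq (fun _ _ _ => 1%N)).
by rewrite !aux => /eqP; rewrite eqn_exp2l // => /eqP.
Qed.

(** For leaves [q = eps - 1], so [b = eps], and [z] is the solution of [1 + q * z = eps * s], giving
    [t = s]. As [z] tends to 1, the inner sum becomes a product; with [y] a power of [s], degree and
    leaf number merge into one exponent. *)
Lemma reg_leaf_expansion (T : sgraph) : is_tree T -> (2 < #|T|)%N ->
  let y := s ^+ #|T| in
  let z := (1 - eps Qs * cst Qs s) / (1 - eps Qs) in
  exists2 r, \sum_(A : {set T}) z ^+ e_in A *
      \prod_(v in A) (pole_x y 1 * cst Qs y ^+ deg v) = eps Qs ^+ #|deg_set T 1| * r &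
    reg r (\prod_(v in ~: deg_set T 1) (1 - s ^+ inner_code v)).
Proof.
move=> treeT T3 y z.
have T0 : (0 < #|T|)%N by apply: leq_trans T3.
have y0 : y != 0 by rewrite expf_neq0 ?eps_neq0.
have e1 : 1 - eps Qs != 0.
  by apply: reg_neq0 (oner_neq0 _); rewrite -[X in reg _ X]subr0; apply: regB (reg1 _) (reg_eps _).
have q1 : 1 + wt y 1 1 = eps Qs by rewrite add1_wt_pole.
have qz : 1 + wt y 1 1 * z = eps Qs * cst Qs s.
  by rewrite wt_pole // -opprB mulNr /z mulrC divfK // opprB addrC subrK.
have pq (l : T) : l \in deg_set T 1 -> pole_x y 1 * cst Qs y ^+ deg l = wt y 1 1.
  move=> lL; have dl : deg l = 1%N by move: lL; rewrite inE => /eqP.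
  rewrite dl; exact: erefl.
rewrite (leaf_expansion treeT T3 pq q1 qz); eexists; first by [].
have -> : \prod_(v in ~: deg_set T 1) (1 - s ^+ inner_code v) =
  \sum_(B : {set T} | B \subset ~: deg_set T 1)
     1 ^+ e_in B * \prod_(v in B) (wt0 y 1 (deg v) * s ^+ #|leaf_nbrs v|).
  under [RHS]eq_bigr do rewrite expr1n mul1r.
  rewrite sum_subsets; apply: eq_bigr => v _; congr (_ + _).
  have d0 : (0 < deg v)%N by rewrite tree_deg_gt0 // ltnW.
  by rewrite /y wt0_exp ?eps_neq0 // mulNr -exprD.
apply: reg_sum => B _; apply: regM.
  apply: regX; rewrite -[X in reg _ X](divr1 1).
  have r1 : reg (1 - eps Qs) 1.
    by rewrite -[X in reg _ X]subr0; apply: regB (reg1 _) (reg_eps _).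
  have r2 : reg (1 - eps Qs * cst Qs s) 1.
    rewrite -[X in reg _ X]subr0 -[X in reg _ (_ - X)](mul0r s).
    by apply: regB (reg1 _) (regM (reg_eps _) (reg_cst _)).
  by apply: (regM r2); apply: regV r1; apply: oner_neq0.
apply: reg_prod => v _; apply: regM; first exact: (reg_wt y 1 (deg v)).
by rewrite -rmorphXn; apply: reg_cst.
Qed.

Lemma inner_code_perm (T T' : sgraph) : gdp T = gdp T' -> is_tree T -> is_tree T' ->
  (2 < #|T|)%N ->
  perm_eq [seq inner_code v | v <- enum (~: deg_set T 1)]
          [seq inner_code v | v <- enum (~: deg_set T' 1)].
Proof.
move=> eqG treeT treeT' T3; have cardE := gdp_card_eq eqG.
have T3' : (2 < #|T'|)%N by rewrite -cardE.
have [r E rr] := reg_leaf_expansion treeT T3.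
have [r' E' rr'] := reg_leaf_expansion treeT' T3'.
have pos (G : sgraph) : is_tree G -> (2 < #|G|)%N ->
    all (leq 1) [seq inner_code v | v <- enum (~: deg_set G 1)].
  move=> tG G3; apply/allP => _ /mapP[v + ->]; rewrite mem_enum !inE => d1.
  have d0 := tree_deg_gt0 tG v (ltnW G3).
  rewrite /inner_code addn_gt0 muln_gt0 (ltnW (ltnW G3)).
  by move: d0 d1; case: (deg v) => [|[|]].
apply: euler_product_eps_uniq; rewrite ?pos // !big_map !big_enum /=.
apply: reg_uniq rr _; suff -> : r = r' by [].
move: E E'; rewrite -cardE (card_deg_set_eq 1 eqG) => E E'.
apply: (mulfI (expf_neq0 #|deg_set T' 1| (eps_neq0 Qs))); rewrite -E -E'.
exact: (gdp_weight_eq eqG).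
Qed.

Lemma sum_inner_eq (T T' : sgraph) (G : nat -> nat -> nat) : gdp T = gdp T' ->
  is_tree T -> is_tree T' -> (2 < #|T|)%N ->
  (\sum_(v in ~: deg_set T 1) G (deg v) #|leaf_nbrs v| =
   \sum_(v in ~: deg_set T' 1) G (deg v) #|leaf_nbrs v|)%N.
Proof.
move=> eqG treeT treeT' T3; have cardE := gdp_card_eq eqG.
(* Decoding of [inner_code] by quotient and remainder. *)
pose H k := G (k %/ #|T|).+1 (k %% #|T|)%N.
have aux (U : sgraph) : is_tree U -> #|U| = #|T| ->
   (\sum_(v in ~: deg_set U 1) G (deg v) #|leaf_nbrs v| =
    \sum_(k <- [seq inner_code v | v <- enum (~: deg_set U 1)]) H k)%N.
  move=> tU UT; rewrite big_map big_enum /=; apply: eq_bigr => v _.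
  have lt : (#|leaf_nbrs v| < #|T|)%N by rewrite -UT (leq_ltn_trans (nbrs_deg _ _) (deg_lt v)).
  have d0 : (0 < deg v)%N by rewrite tree_deg_gt0 // UT ltnW.
  have T0 : (0 < #|T|)%N by apply: leq_trans T3.
  rewrite /H /inner_code UT mulnC divnMDl // divn_small // addn0 prednK //.
  by rewrite modnMDl modn_small.
rewrite (aux T) // (aux T') //; apply: perm_big.
exact: inner_code_perm.
Qed.

Lemma embs_star_eq (D : sgraph) (a : D -> nat) (T T' : sgraph) :
  gdp T = gdp T' -> is_tree T -> is_tree T' -> (forall u, (0 < a u)%N) ->
  star_outer1 a -> #|embs a T| = #|embs a T'|.
Proof.
move=> eqG treeT treeT' a0 [c [starD out1]]; have cardE := gdp_card_eq eqG.
rewrite !(card_embs_star _ starD out1); move: (a c) (a0 c) => d d0; move: #|D|.-1 => k.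
have degE := card_deg_set_eq d eqG.
(* With at most two vertices, a vertex of positive degree forces a single edge, the one tree with
   adjacent leaves. *)
case: (ltnP 2 #|T|) => T3; last first.
  have small (U : sgraph) : is_tree U -> (#|U| <= 2)%N ->
      (\sum_(v in deg_set U d) #|leaf_nbrs v| ^_ k = #|deg_set U d| * (1 ^_ k))%N.
    move=> tU U2; rewrite -sum_nat_const; apply: eq_bigr => v; rewrite inE => /eqP dv.
    have U1 : (1 < #|U|)%N by apply: leq_trans (deg_lt v); rewrite dv.
    have d1 (w : U) : deg w = 1%N.
      by apply/eqP; rewrite eqn_leq tree_deg_gt0 // andbT -ltnS (leq_trans (deg_lt w) U2).
    congr (_ ^_ _); rewrite -(d1 v); apply: eq_card => w; rewrite !inE d1 eqxx.
    by [].
  by rewrite !small -?cardE // degE.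
have T3' : (2 < #|T'|)%N by rewrite -cardE.
(* A leaf has no leaf neighbour, so every term is [0 ^_ k], which is 1 when the star is a single
   vertex. *)
have [->|d1] := eqVneq d 1%N.
  have leaf (U : sgraph) : is_tree U -> (2 < #|U|)%N ->
      (\sum_(v in deg_set U 1) #|leaf_nbrs v| ^_ k = #|deg_set U 1| * (0 ^_ k))%N.
    move=> tU U3; rewrite -sum_nat_const; apply: eq_bigr => v; rewrite inE => /eqP dv.
    congr (_ ^_ _); apply: eq_card0 => w; rewrite !inE; apply/negP => /andP[dw vw].
    by have := leaves_not_adj tU U3 dv vw; rewrite dw.
  by rewrite !leaf // (card_deg_set_eq 1 eqG).
have inner (U : sgraph) : (\sum_(v in deg_set U d) #|leaf_nbrs v| ^_ k =
   \sum_(v in ~: deg_set U 1) (fun i l => if i == d then l ^_ k else 0) (deg v) #|leaf_nbrs v|)%N.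
  rewrite big_mkcond [RHS]big_mkcond; apply: eq_bigr => v _; rewrite !inE.
  by case: eqP => [->|_]; rewrite ?d1 //; case: ifP.
by rewrite !inner; apply: sum_inner_eq (fun i l => if i == d then (l ^_ k)%N else 0%N) eqG _ _ _.
Qed.
End StarEq.

Theorem theorem3p4 (D : sgraph) (a : D -> nat)
    (treeD : is_tree D) (a_pos : forall u : D, 0 < a u)
    (kindD : path2 D \/ path3_const a \/ path3_aab a \/ path_all2 a
             \/ star_outer1 a)
    (T T' : sgraph) (treeT : is_tree T) (treeT' : is_tree T')
    (eqG : gdp T = gdp T') :
  deg_emb_num a T = deg_emb_num a T'.
Proof.
apply: (deg_emb_num_eq treeD); case: kindD => [kD|[kD|[kD|[kD|kD]]]].
- exact: (embs_path2_eq _ eqG kD).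
- exact: (embs_path3_const_eq eqG kD).
- exact: (embs_path3_aab_eq eqG a_pos kD).
- exact: (embs_path_all2_eq eqG treeD treeT treeT' kD).
- exact: (embs_star_eq eqG treeT treeT' a_pos kD).
Qed.
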